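(* Let $\lambda$ be an arbitrary frequency. The democracy and super-democracy functions of the canonical basis $\mathcal B=\{e^{-\lambda_n s}\}$ in $\mathcal H_p^\lambda$ satisfy: (a) If $p=1$: (i) $\log(N)\lesssim\varphi_{l,\mathcal E}^{1,\lambda}(N)\le\varphi_l^{1,\lambda}(N)\lesssim N^{1/2}$; (ii) $\varphi_u^{1,\lambda}(N)\approx\varphi_{u,\mathcal E}^{1,\lambda}(N)\approx N^{1/2}$. (b) If $1<p\le2$: (i) $N^{1/p'}\lesssim\varphi_{l,\mathcal E}^{p,\lambda}(N)\le\varphi_l^{p,\lambda}(N)\lesssim N^{1/2}$; (ii) $\varphi_u^{p,\lambda}(N)\approx\varphi_{u,\mathcal E}^{p,\lambda}(N)\approx N^{1/2}$. (c) If $2<p<\infty$: (i) $\varphi_{l,\mathcal E}^{p,\lambda}(N)\approx\varphi_l^{p,\lambda}(N)\approx N^{1/2}$; (ii) $N^{1/2}\lesssim\varphi_u^{p,\lambda}(N)\approx\varphi_{u,\mathcal E}^{p,\lambda}(N)\lesssim N^{1/p'}$. (d) If $p=\infty$: (i) $N^{1/2}\lesssim\varphi_{l,\mathcal E}^{\infty,\lambda}(N)\le\varphi_l^{\infty,\lambda}(N)=N$; (ii) $\varphi_u^{\infty,\lambda}(N)=\varphi_{u,\mathcal E}^{\infty,\lambda}(N)=N$.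
   Context: A frequency is a strictly increasing unbounded sequence $\lambda=(\lambda_n)_{n\ge1}$ of non-negative real numbers. A $\lambda$-Dirichlet polynomial is a finite sum $D=\sum_{n\in A}a_n e^{-\lambda_n s}$, with $A\subset\mathbb N$ finite and $a_n\in\mathbb C$. Its norms are $\|D\|_{\mathcal H_p^\lambda}=\lim_{R\to\infty}\big(\frac1{2R}\int_{-R}^R|\sum_{n\in A}a_n e^{-\lambda_n it}|^p\,dt\big)^{1/p}$ for $1\le p<\infty$ and $\|D\|_{\mathcal H_\infty^\lambda}=\sup_{t\in\mathbb R}|\sum_{n\in A}a_n e^{-i\lambda_n t}|$. For $1\le p<\infty$, $\mathcal H_p^\lambda$ is the completion of the space of $\lambda$-Dirichlet polynomials under $\|\cdot\|_{\mathcal H_p^\lambda}$; for $p=\infty$ only the norms of Dirichlet polynomials matter here (their completion is denoted $\mathcal A_\infty^\lambda$). For a finite set $A\subset\mathbb N$ let $\mathcal E_A$ be the set of families $\varepsilon=(\varepsilon_n)_{n\in A}$ of complex numbers with $|\varepsilon_n|=1$. Put $\mathbf 1_{\varepsilon,A}=\sum_{n\in A}\varepsilon_n e^{-\lambda_n s}$ and $\mathbf 1_A=\sum_{n\in A}e^{-\lambda_n s}$ (empty sums are $0$). For $N\in\mathbb N$, with $A$ ranging over finite subsets of $\mathbb N$ and all norms taken in $\mathcal H_p^\lambda$: $\varphi_u^{p,\lambda}(N)=\sup\{\|\mathbf 1_A\|:|A|\le N\}$, $\varphi_l^{p,\lambda}(N)=\inf\{\|\mathbf 1_A\|:|A|\ge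 N\}$, $\varphi_{u,\mathcal E}^{p,\lambda}(N)=\sup\{\|\mathbf 1_{\varepsilon,A}\|:|A|\le N,\ \varepsilon\in\mathcal E_A\}$, $\varphi_{l,\mathcal E}^{p,\lambda}(N)=\inf\{\|\mathbf 1_{\varepsilon,A}\|:|A|\ge N,\ \varepsilon\in\mathcal E_A\}$. $p'$ is the conjugate exponent, $\frac1p+\frac1{p'}=1$. $f(N)\lesssim g(N)$ means that there is a constant $C>0$ independent of $N$ with $f(N)\le Cg(N)$ for all $N$; $f\approx g$ means $f\lesssim g$ and $g\lesssim f$. *)

(* Defs.v *)
From HB Require Import structures.
From mathcomp Require Import all_boot all_order all_algebra.
From mathcomp Require Import finmap.
From mathcomp Require Import all_classical all_reals all_analysis.
From mathcomp Require Import complex.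
Set Implicit Arguments.
Unset Strict Implicit.
Unset Printing Implicit Defensive.
Import Order.TTheory GRing.Theory Num.Theory.
Import numFieldNormedType.Exports.
Local Open Scope classical_set_scope.
Local Open Scope ring_scope.
Local Open Scope complex_scope.

Section Defs.
Context {R : realType}.
Implicit Types (lambda : nat -> R) (A : {fset nat}) (a eps : nat -> R[i]).
Implicit Types (p : \bar R) (N : nat) (f g : nat -> \bar R).

(* Terms are indexed from 0: [lambda n] is the (n+1)-st term of the frequency. *)
Definition frequency lambda : Prop :=
  [/\ forall n, 0 <= lambda n,
      {homo lambda : m n / (m < n)%N >-> m < n}
    & ~ has_ubound (range lambda)].

Definition cmod (z : R[i]) : R := Normc.normc z.

Definition cexp (z : R[i]) : R[i] :=
  (expR (complex.Re z) * cos (complex.Im z))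
    +i* (expR (complex.Re z) * sin (complex.Im z)).

(* Only the values of [a] on [A] matter. *)
Definition dirichlet_poly lambda A a (s : R[i]) : R[i] :=
  \sum_(n <- A) a n * cexp (- ((lambda n)%:C * s)).

(* [lim] is total; for finite p >= 1 the limit exists because |D(it)|^p is an
   almost periodic function of t.  The value at p = -oo is junk. *)
Definition Hnorm lambda p A a : \bar R :=
  match p with
  | r%:E => (lim (((2 * T)^-1 *
        \int[lebesgue_measure]_(t in `[- T, T])
          (cmod (dirichlet_poly lambda A a (0 +i* t)) `^ r)) `^ r^-1
        @[T --> +oo]))%:E
  | +oo%E =>
      ereal_sup (range (fun t : R =>
        (cmod (dirichlet_poly lambda A a (0 +i* t)))%:E))
  | -oo%E => 0%E
  end.

Definition unimodular A eps : Prop := forall n, n \in A -> cmod (eps n) = 1.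

Definition phi_u lambda p N : \bar R :=
  ereal_sup [set x | exists A,
    (#|` A| <= N)%N /\ x = Hnorm lambda p A (fun=> 1)].

Definition phi_l lambda p N : \bar R :=
  ereal_inf [set x | exists A,
    (N <= #|` A|)%N /\ x = Hnorm lambda p A (fun=> 1)].

Definition phi_uE lambda p N : \bar R :=
  ereal_sup [set x | exists A eps,
    [/\ (#|` A| <= N)%N, unimodular A eps & x = Hnorm lambda p A eps]].

Definition phi_lE lambda p N : \bar R :=
  ereal_inf [set x | exists A eps,
    [/\ (N <= #|` A|)%N, unimodular A eps & x = Hnorm lambda p A eps]].

(* N ranges over the positive integers. *)
Definition lesssim f g : Prop :=
  exists2 C : R, 0 < C & forall N, (0 < N)%N -> (f N <= C%:E * g N)%E.

Definition asympt f g : Prop := lesssim f g /\ lesssim g f.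

Definition logN N : \bar R := (ln (N%:R : R))%:E.

Definition powN (r : R) N : \bar R := ((N%:R : R) `^ r)%:E.

End Defs.

(* Main.v *)
Require Import Defs.
From mathcomp Require Import all_boot all_order all_algebra.
From mathcomp Require Import finmap.
From mathcomp Require Import all_classical all_reals all_analysis.
From mathcomp Require Import complex.
From mathcomp Require Import ring lra.
Set Implicit Arguments.
Unset Strict Implicit.
Unset Printing Implicit Defensive.
Import Order.TTheory GRing.Theory Num.Theory.
Import numFieldNormedType.Exports.
Local Open Scope classical_set_scope.
Local Open Scope ring_scope.
Local Open Scope complex_scope.

(** Write M for the mean value over the real line and D for a polynomial with
n unimodular coefficients, restricted to the imaginary axis.  The theorem rests
on two quantities, M|D|^2 = n [parseval] and sup |D| <= n, and on the fact that
most comparisons between the p-th powers hold pointwise before taking means.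

The mean of |D|^p exists because |D|^p is a uniform limit of real trigonometric
polynomials: |D|^2 is one, and x^(p/2) is a uniform limit of polynomials
[approx_powR_cmod].  With s = |D|^2 / n, the tangent line of s^(p/2) at s = 1
bounds the p-norm by n^(1/2), from above if p <= 2 and from below if p >= 2.
Comparing |D|^p with n^(p-2) |D|^2 gives the bounds n^(1/p').

In the other direction the extremal sets are sparse.  If each frequency exceeds
a large multiple of the previous ones, the sum of n exponentials satisfies
M|D|^(2k) <= k! n^k [moment_sparse].  For p > 2 this bounds the p-norm by a
multiple of n^(1/2); for p <= 2 the case k = 2 keeps the p-norm above a multiple
of n^(1/2), as the fourth moment prevents the mass of |D|^2 from concentrating.

Coefficients reduce to indicators by convexity: M|.|^p is convex, so on a cube
of coefficients it is maximal at a vertex [mean_powR_vertex], and a unimodular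
family splits into four families with coefficients in [0, 1].

The lower bound log n for p = 1 is Littlewood's conjecture, and the argument is
that of McGehee, Pigno and Smith, carried out for means over the line
[littlewood_blocks].  Cut D into consecutive blocks P_j of 4^j terms.  One
builds a test function G = sum_j g_j W_j, where g_j is 4^-j times the conjugate
of P_j and W_j is a product of multipliers E_i, i > j.  Each E_i is a
trigonometric polynomial with nonpositive spectrum, small where g_i is large,
and close to 1 in quadratic mean [outer_multiplier].  Smallness keeps G bounded;
the one-sided spectrum makes the terms of D after the j-th block invisible to
g_j W_j; closeness to 1 then shows that each block contributes at least 1/2 to
the real part of M(D G).  So M|D| is at least a multiple of the number of
blocks. *)

(** * Bernstein approximation *)
Section Bernstein.
Context {R : realType}.
Implicit Types (phi : nat -> R) (x c : R).

(** The Bernstein polynomial of degree [n], as the expectation of [phi] at the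
number of successes in [n] trials of probability [x], by conditioning on one
trial.  In this form, stability of a ring of functions under [bern] and the
second moment are immediate inductions. *)
Fixpoint bern n phi x : R :=
  if n is n'.+1 then x * bern n' (phi \o succn) x + (1 - x) * bern n' phi x
  else phi 0%N.

Lemma bern_moment2 n c x :
  bern n (fun k => (k%:R - c) ^+ 2) x
    = n%:R * x * (1 - x) + (n%:R * x - c) ^+ 2.
Proof.
elim: n c => [|n IHn] c /=; first by ring.
have -> : (fun k => (k%:R - c) ^+ 2) \o succn
    = (fun k => (k%:R - (c - 1)) ^+ 2).
  by apply/funext => k /=; rewrite -natr1; ring.
by rewrite !IHn -natr1; ring.
Qed.

(** [bern] is an average with nonnegative weights, so a bound at each node
averages to a bound on the difference. *)
Lemma bern_near n phi x l a b c : 0 <= x <= 1 ->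
  (forall k, (k <= n)%N -> `|phi k - l| <= a + b * (k%:R - c) ^+ 2) ->
  `|bern n phi x - l| <= a + b * bern n (fun k => (k%:R - c) ^+ 2) x.
Proof.
move=> /andP[x0 x1]; elim: n phi c => [|n IHn] phi c H /=; first exact: H.
have -> : (fun k => (k%:R - c) ^+ 2) \o succn
    = (fun k => (k%:R - (c - 1)) ^+ 2).
  by apply/funext => k /=; rewrite -natr1; ring.
have h0 := IHn phi c (fun k kn => H k (leqW kn)).
have h1 : `|bern n (phi \o succn) x - l|
    <= a + b * bern n (fun k => (k%:R - (c - 1)) ^+ 2) x.
  apply: IHn => k kn /=; have := H k.+1 kn.
  by rewrite (_ : k.+1%:R - c = k%:R - (c - 1)) // -natr1; ring.
move: h0 h1.
set s := bern n phi x; set t := bern n (phi \o succn) x.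
set u := bern n _ x; set v := bern n _ x => h0 h1.
have -> : x * t + (1 - x) * s - l = x * (t - l) + (1 - x) * (s - l) by ring.
have -> : a + b * (x * v + (1 - x) * u)
    = x * (a + b * v) + (1 - x) * (a + b * u) by ring.
have x1' : 0 <= 1 - x by rewrite subr_ge0.
apply: (le_trans (ler_normD _ _)); rewrite !normrM.
by rewrite (ger0_norm x0) (ger0_norm x1') lerD// ler_wpM2l.
Qed.

(** The modulus of continuity is encoded as an offset plus a quadratic term:
it is what the second moment of the Bernstein weights can absorb, and any
uniformly continuous function satisfies it. *)
Lemma bern_approx (F : R -> R) :
  (forall e, 0 < e -> exists2 K, 0 <= K & forall x y, 0 <= x <= 1 ->
     0 <= y <= 1 -> `|F y - F x| <= e + K * (y - x) ^+ 2) ->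
  forall e, 0 < e -> exists n phi, forall x, 0 <= x <= 1 ->
    `|bern n phi x - F x| <= e.
Proof.
move=> H e e0.
have [|K K0 HK] := H (e / 2); first by rewrite divr_gt0.
pose n := (Num.truncn (K / e)).+1.
have n0 : 0 < n%:R :> R by rewrite ltr0n.
have nK : K / e <= n%:R by exact/ltW/Num.Theory.truncnS_gt.
exists n, (fun k => F (k%:R / n%:R)) => x x01.
have h := @bern_near n (fun k => F (k%:R / n%:R)) x (F x) (e / 2)
  (K / n%:R ^+ 2) (n%:R * x) x01.
apply: (le_trans (h _)).
  move=> k kn; apply: le_trans (HK x (k%:R / n%:R) x01 _) _.
    by rewrite divr_ge0//= ler_pdivrMr// mul1r ler_nat.
  rewrite lerD2l -mulrA ler_wpM2l// -exprVn -exprMn.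
  by rewrite (_ : n%:R^-1 * _ = k%:R / n%:R - x)//; field; rewrite gt_eqF.
rewrite bern_moment2 subrr expr0n/= addr0.
have -> : K / n%:R ^+ 2 * (n%:R * x * (1 - x)) = K / n%:R * (x * (1 - x)).
  by field; rewrite gt_eqF.
have Kn : K / n%:R <= e.
  by rewrite ler_pdivrMr// mulrC -ler_pdivrMr.
have Kn0 : 0 <= K / n%:R by rewrite divr_ge0.
have xx : x * (1 - x) <= 2^-1 by nra.
have xx0 : 0 <= x * (1 - x) by case/andP: x01 => *; rewrite mulr_ge0// subr_ge0.
have : K / n%:R * (x * (1 - x)) <= e * 2^-1 by exact: ler_pM.
lra.
Qed.

End Bernstein.

(** * Mean values *)
Section Means.
Context {R : realType}.
Implicit Types (f g : R -> R).
Local Notation mu := (@lebesgue_measure R).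

Definition avg f (T : R) : R := (2 * T)^-1 * \int[mu]_(t in `[- T, T]) f t.

Definition is_mean f (l : R) : Prop :=
  continuous f /\ avg f T @[T --> +oo] --> l.

Let integrable_cont f T : continuous f -> mu.-integrable `[- T, T] (EFin \o f).
Proof.
move=> cf; apply: continuous_compact_integrable; first exact: segment_compact.
exact: continuous_subspaceT.
Qed.

Let avgD f g T : continuous f -> continuous g ->
  avg (fun t => f t + g t) T = avg f T + avg g T.
Proof.
move=> cf cg; rewrite /avg RintegralD//; first by rewrite mulrDr.
- exact: integrable_cont.
- exact: integrable_cont.
Qed.

Let avg_cst c T : 0 < T -> avg (fun=> c) T = c.
Proof.
move=> T0; rewrite /avg Rintegral_cst//= lebesgue_measure_itv /= lte_fin.
rewrite ifT; last lra.
by rewrite -EFinD /=; field; rewrite gt_eqF.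
Qed.

Let le_avg f g T : 0 < T -> continuous f -> continuous g ->
  (forall t, f t <= g t) -> avg f T <= avg g T.
Proof.
move=> T0 cf cg fg; rewrite /avg ler_wpM2l//.
  by rewrite invr_ge0 mulr_ge0// ltW.
by apply: le_Rintegral => //; exact: integrable_cont.
Qed.

Lemma is_meanD f g l m :
  is_mean f l -> is_mean g m -> is_mean (fun t => f t + g t) (l + m).
Proof.
move=> [cf fl] [cg gm]; split; first by move=> x; apply: cvgD; [exact: cf|exact: cg].
have -> : avg (fun t => f t + g t) = avg f \+ avg g.
  by apply/funext => T; exact: avgD.
exact: cvgD.
Qed.

Lemma is_meanZ f l c : is_mean f l -> is_mean (fun t => c * f t) (c * l).
Proof.
move=> [cf fl]; split; first by move=> x; apply: cvgMr => //; exact: cf.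
have -> : avg (fun t => c * f t) = (fun T => c * avg f T).
  apply/funext => T; rewrite /avg /= RintegralZl//; first by rewrite mulrCA.
  exact: integrable_cont.
exact: cvgMr.
Qed.

Lemma is_mean_cst c : is_mean (fun=> c) c.
Proof.
split; first by move=> x; exact: cvg_cst.
apply: cvg_near_cst; near=> T.
by apply: avg_cst; near: T; exact: nbhs_pinfty_gt.
Unshelve. all: by end_near. Qed.

Lemma is_mean_le f g l m :
  is_mean f l -> is_mean g m -> (forall t, f t <= g t) -> l <= m.
Proof.
move=> [cf fl] [cg gm] fg.
rewrite -(cvg_lim _ fl)// -(cvg_lim _ gm)//; apply: ler_lim.
- by apply/cvg_ex; exists l.
- by apply/cvg_ex; exists m.
near=> T; apply: le_avg => //; near: T; exact: nbhs_pinfty_gt.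
Unshelve. all: by end_near. Qed.

(** The averages of [f] inherit the Cauchy property from those of functions
uniformly close to [f]; this is how functions outside the algebra of
trigonometric polynomials get a mean. *)
Lemma is_mean_uniform f :
  (forall e, 0 < e ->
     exists g l, is_mean g l /\ forall t, `|f t - g t| <= e) ->
  exists l, is_mean f l.
Proof.
move=> H.
have cf : continuous f.
  move=> x; apply/cvgrPdist_le => e e0.
  have [|g [l [[cg _] fg]]] := H (e / 3); first by rewrite divr_gt0.
  have gx : \forall y \near x, `|g x - g y| <= e / 3.
    by move/cvgrPdist_le : (cg x); apply; rewrite divr_gt0.
  near=> y.
  have h1 : `|g x - g y| <= e / 3 by near: y.
  have := fg x; have := fg y; move: h1; rewrite !ler_norml.
  by move=> /andP[? ?] /andP[? ?] /andP[? ?]; apply/andP; split; lra.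
suff /cvg_ex[l fl] : cvg (avg f T @[T --> +oo]) by exists l.
apply/cauchy_cvgP/cauchy_exP => e e0.
have [|g [l [[cg gl] fg]]] := H (e / 3); first by rewrite divr_gt0.
exists l; rewrite /= nbhs_simpl/=.
have gx : \forall T \near +oo, `|l - avg g T| <= e / 3.
  by move/cvgrPdist_le : gl; apply; rewrite divr_gt0.
near=> T.
have T0 : 0 < T by near: T; exact: nbhs_pinfty_gt.
have h1 : `|l - avg g T| <= e / 3 by near: T.
have ce (c : R) : continuous (fun _ : R => c) by move=> x; exact: cvg_cst.
have h2 : avg f T <= avg g T + e / 3.
  rewrite -(@avg_cst (e / 3) T T0) -avgD//; apply: le_avg => //.
    by move=> x; apply: cvgD; [exact: cg|exact: ce].
  by move=> t; have := fg t; rewrite ler_norml => /andP[? ?]; lra.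
have h3 : avg g T <= avg f T + e / 3.
  rewrite -(@avg_cst (e / 3) T T0) -avgD//; apply: le_avg => //.
    by move=> x; apply: cvgD; [exact: cf|exact: ce].
  by move=> t; have := fg t; rewrite ler_norml => /andP[? ?]; lra.
rewrite /ball /= ltr_norml; move: h1; rewrite ler_norml => /andP[? ?].
by apply/andP; split; lra.
Unshelve. all: by end_near. Qed.

Lemma is_mean_cos c d : c != 0 -> is_mean (fun t => cos (c * t + d)) 0.
Proof.
move=> c0.
have cc : continuous (fun t : R => cos (c * t + d)).
  move=> x; apply: (@continuous_comp _ _ _ (fun t => c * t + d) (@cos R)).
    by apply: cvgD; [apply: cvgMr => //; exact: cvg_id|exact: cvg_cst].
  exact: continuous_cos.
split => //; apply/cvgr0Pnorm_le => e e0; near=> T.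
have T0 : 0 < T by near: T; exact: nbhs_pinfty_gt.
pose F := fun t : R => c^-1 * sin (c * t + d).
have dF (x : R) : is_derive x 1 F (cos (c * x + d)).
  by apply: is_derive_eq; rewrite /GRing.scale /= !mulr1 addr0; field.
have cF : continuous F.
  move=> x; apply/differentiable_continuous/derivable1_diffP.
  by have [] := dF x.
rewrite /avg /Rintegral (@continuous_FTC2 _ _ F).
- rewrite -EFinD /= /F.
  have -> : (2 * T)^-1 * (c^-1 * sin (c * T + d) - c^-1 * sin (c * - T + d))
      = c^-1 * T^-1 * ((sin (c * T + d) - sin (c * - T + d)) / 2).
    by field; rewrite c0 gt_eqF.
  rewrite !normrM (ger0_norm (_ : 0 <= T^-1)); last by rewrite invr_ge0 ltW.
  apply: (@le_trans _ _ (`|c^-1| * T^-1)).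
    have : `|sin (c * T + d) - sin (c * - T + d)| * `|2^-1 : R| <= 1.
      rewrite -normrM ler_norml.
      have := sin_geN1 (c * T + d); have := sin_geN1 (c * - T + d).
      have := sin_le1 (c * T + d); have := sin_le1 (c * - T + d).
      by move=> ? ? ? ?; apply/andP; split; lra.
    move=> h; rewrite -[leRHS]mulr1; apply: ler_wpM2l => //.
    by rewrite mulr_ge0// invr_ge0 ltW.
  rewrite ler_pdivrMr// -ler_pdivrMl//.
- lra.
- exact: continuous_subspaceT.
- split.
  + by move=> x _; have [] := dF x.
  + by apply: cvg_at_right_filter; exact: cF.
  + by apply: cvg_at_left_filter; exact: cF.
- by move=> x _; rewrite derive1E; exact: derive_val.
Unshelve. all: by end_near. Qed.

End Means.

(** * Trigonometric polynomials *)
Section Modulus.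
Context {R : realType}.
Implicit Types z w : R[i].

Lemma sqr_cmod z : cmod z ^+ 2 = complex.Re z ^+ 2 + complex.Im z ^+ 2.
Proof. by case: z => a b; rewrite /cmod /= sqr_sqrtr// addr_ge0// sqr_ge0. Qed.

Lemma cmod_ge0 z : 0 <= cmod z.
Proof. by case: z => a b; exact: sqrtr_ge0. Qed.

Lemma cmodM z w : cmod (z * w) = cmod z * cmod w.
Proof. exact: Normc.normcM. Qed.

Lemma ler_cmodD z w : cmod (z + w) <= cmod z + cmod w.
Proof. exact: le_normcD. Qed.

Lemma cmodN z : cmod (- z) = cmod z.
Proof. exact: normcN. Qed.

Lemma cmod0 : cmod (0 : R[i]) = 0.
Proof. exact: Normc.normc0. Qed.

Lemma cmod1 : cmod (1 : R[i]) = 1.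
Proof. exact: Normc.normc1. Qed.

Lemma cmodC (x : R) : cmod x%:C = `|x|.
Proof. by rewrite /cmod /= expr0n /= addr0 sqrtr_sqr. Qed.

Lemma cmod_conj z : cmod (conjc z) = cmod z.
Proof. by case: z => a b; rewrite /cmod /= sqrrN. Qed.

Lemma ler_Re_cmod z : complex.Re z <= cmod z.
Proof.
apply: le_trans (ler_norm _) _.
by rewrite -(@ler_pXn2r _ 2) ?nnegrE ?cmod_ge0// real_normK ?num_real// sqr_cmod
  lerDl sqr_ge0.
Qed.

Lemma ReD z w : complex.Re (z + w) = complex.Re z + complex.Re w.
Proof. by case: z w => a b []. Qed.

Lemma ReZ (c : R) z : complex.Re (c%:C * z) = c * complex.Re z.
Proof. by case: z => a b /=; rewrite mul0r subr0. Qed.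

Lemma Re_mulJJ z w : complex.Re (conjc z * conjc w) = complex.Re (z * w).
Proof. by case: z w => a b [c d] /=; ring. Qed.

Lemma Re_mulJ z w :
  complex.Re z * complex.Re w = complex.Re ((2^-1)%:C * (z * (w + conjc w))).
Proof. by case: z w => a b [c d] /=; field. Qed.

Lemma mulJ_cmod z : z * conjc z = (cmod z ^+ 2)%:C.
Proof.
by rewrite sqr_cmod; case: z => a b; apply/eqP; rewrite eq_complex /=; apply/andP;
  split; apply/eqP; ring.
Qed.

Lemma sqr_cmodE z : cmod z ^+ 2 = complex.Re (z * conjc z).
Proof. by rewrite mulJ_cmod. Qed.

Lemma sqr_cmodD z w :
  cmod (z + w) ^+ 2 = cmod z ^+ 2 + cmod w ^+ 2 + 2 * complex.Re (z * conjc w).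
Proof. by rewrite !sqr_cmod; case: z w => a b [c d] /=; ring. Qed.

End Modulus.

Section TrigPoly.
Context {R : realType}.
Implicit Types (S T U : set R) (f g F G : R -> R[i]) (m n t : R) (c : R[i]).

Definition ee m t : R[i] := cos (m * t) +i* sin (m * t).

Lemma eeD m n t : ee (m + n) t = ee m t * ee n t.
Proof.
by rewrite /ee mulrDl cosD sinD; apply/eqP; rewrite eq_complex /= eqxx/= addrC.
Qed.

Lemma ee0 t : ee 0 t = 1.
Proof. by rewrite /ee mul0r cos0 sin0. Qed.

Lemma ee_conj m t : conjc (ee m t) = ee (- m) t.
Proof. by rewrite /ee /= mulNr cosN sinN. Qed.

Lemma cmod_ee m t : cmod (ee m t) = 1.
Proof. by rewrite /cmod /= cos2Dsin2 sqrtr1. Qed.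

(** Only an inclusion of the spectrum in [S] is recorded, so that sums,
products and conjugates need no cancellation bookkeeping. *)
Inductive trigpoly S : (R -> R[i]) -> Prop :=
| trigpoly0 : trigpoly S (fun=> 0)
| trigpoly_cons c m f : S m -> trigpoly S f ->
    trigpoly S (fun t => c * ee m t + f t).

Lemma trigpolyW S T f : S `<=` T -> trigpoly S f -> trigpoly T f.
Proof.
move=> ST; elim=> [|c m {}f Sm _ IH]; first exact: trigpoly0.
by apply: trigpoly_cons => //; exact: ST.
Qed.

Lemma trigpoly_term S c m : S m -> trigpoly S (fun t => c * ee m t).
Proof.
move=> Sm; rewrite (_ : (fun t => _) = (fun t => c * ee m t + 0)).
  by apply: trigpoly_cons => //; exact: trigpoly0.
by apply/funext => t; rewrite addr0.
Qed.

Lemma trigpoly_cst S c : S 0 -> trigpoly S (fun=> c).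
Proof.
move=> S0; rewrite (_ : (fun=> c) = (fun t => c * ee 0 t)).
  exact: trigpoly_term.
by apply/funext => t; rewrite ee0 mulr1.
Qed.

Lemma trigpolyD S f g : trigpoly S f -> trigpoly S g ->
  trigpoly S (fun t => f t + g t).
Proof.
move=> Sf Sg; elim: Sf => [|c m {}f Sm _ IH].
  by rewrite (_ : (fun t => _) = g)//; apply/funext => t; rewrite add0r.
rewrite (_ : (fun t => _) = (fun t => c * ee m t + (f t + g t))).
  exact: trigpoly_cons.
by apply/funext => t; rewrite addrA.
Qed.

Lemma trigpolyM S T U f g : (forall m n, S m -> T n -> U (m + n)) ->
  trigpoly S f -> trigpoly T g -> trigpoly U (fun t => f t * g t).
Proof.
move=> STU Sf Tg; elim: Sf => [|c m {}f Sm _ IH].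
  rewrite (_ : (fun t => _) = (fun=> 0)); first exact: trigpoly0.
  by apply/funext => t; rewrite mul0r.
rewrite (_ : (fun t => _) = (fun t => c * ee m t * g t + f t * g t)); last first.
  by apply/funext => t; rewrite mulrDl.
apply: (trigpolyD _ IH) => {IH}; elim: Tg => [|d n {}g Tn _ IH'].
  rewrite (_ : (fun t => _) = (fun=> 0)); first exact: trigpoly0.
  by apply/funext => t; rewrite mulr0.
rewrite (_ : (fun t => _)
  = (fun t => (c * d) * ee (m + n) t + c * ee m t * g t)); last first.
  by apply/funext => t; rewrite eeD; ring.
by apply: trigpoly_cons => //; exact: STU.
Qed.

Lemma trigpolyZ S c f : trigpoly S f -> trigpoly S (fun t => c * f t).
Proof.
move=> Sf; apply: (@trigpolyM [set 0]) Sf; last exact: trigpoly_cst.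
by move=> m n -> Sn; rewrite add0r.
Qed.

Lemma trigpoly_conj S T f : (forall m, S m -> T (- m)) ->
  trigpoly S f -> trigpoly T (fun t => conjc (f t)).
Proof.
move=> ST; elim=> [|c m {}f Sm _ IH].
  rewrite (_ : (fun t => _) = (fun=> 0)); first exact: trigpoly0.
  by apply/funext => t; rewrite conjc0.
rewrite (_ : (fun t => _) = (fun t => conjc c * ee (- m) t + conjc (f t))).
  by apply: trigpoly_cons => //; exact: ST.
by apply/funext => t; rewrite rmorphD rmorphM /= -ee_conj.
Qed.

Lemma trigpoly_sum S (I : eqType) (r : seq I) (f : I -> R -> R[i]) :
  (forall i, i \in r -> trigpoly S (f i)) ->
  trigpoly S (fun t => \sum_(i <- r) f i t).
Proof.
elim: r => [_|i r IH H].
  rewrite (_ : (fun t => _) = (fun=> 0)); first exact: trigpoly0.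
  by apply/funext => t; rewrite big_nil.
rewrite (_ : (fun t => _) = (fun t => f i t + \sum_(j <- r) f j t)); last first.
  by apply/funext => t; rewrite big_cons.
apply: trigpolyD; first by apply: H; rewrite mem_head.
by apply: IH => j jr; apply: H; rewrite in_cons jr orbT.
Qed.

Lemma trigpoly_bounded S f : trigpoly S f ->
  exists2 B : R, 0 < B & forall t, cmod (f t) <= B.
Proof.
elim=> [|c m {}f Sm _ [B B0 HB]]; first by exists 1 => // t; rewrite cmod0.
exists (cmod c + B); first by rewrite ltr_wpDl// cmod_ge0.
move=> t; apply: le_trans (ler_cmodD _ _) _.
by rewrite cmodM cmod_ee mulr1 lerD2l.
Qed.

(** A real trigonometric polynomial only sees its spectrum up to sign, so its
spectrum may be folded onto the negative half line. *)
Lemma trigpoly_fold f : trigpoly setT f ->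
  exists (c : R) k, trigpoly [set m | m < 0] k /\
    forall t, complex.Re (f t) = c + complex.Re (k t).
Proof.
elim=> [|d m {}f _ _ [c [k [Sk H]]]].
  by exists 0, (fun=> 0); split; [exact: trigpoly0|move=> t; rewrite addr0].
have [m0|m0|->] := ltrgtP m 0.
- exists c, (fun t => d * ee m t + k t); split; first exact: trigpoly_cons.
  by move=> t; rewrite !ReD H; ring.
- exists c, (fun t => conjc d * ee (- m) t + k t); split.
    by apply: trigpoly_cons => //=; rewrite oppr_lt0.
  by move=> t; rewrite !ReD H -ee_conj ?Re_mulJJ; ring.
- exists (complex.Re d + c), k; split => // t.
  by rewrite ReD H ee0 mulr1 addrA.
Qed.

(** A constant term is the only obstruction to a vanishing mean. *)
Lemma is_mean_trigpoly S f : ~ S 0 -> trigpoly S f ->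
  is_mean (fun t => complex.Re (f t)) 0.
Proof.
move=> S0; elim=> [|c m {}f Sm _ IH]; first exact: is_mean_cst.
have m0 : m != 0 by apply/eqP => m0; rewrite m0 in Sm.
have -> : (fun t => complex.Re (c * ee m t + f t))
    = (fun t => complex.Re c * cos (m * t + 0)
      + complex.Im c * cos (m * t + pi / 2) + complex.Re (f t)).
  apply/funext => t; rewrite ReD; congr (_ + _).
  by rewrite addr0 cosDpihalf; case: c => a b /=; ring.
rewrite (_ : 0 = complex.Re c * 0 + complex.Im c * 0 + 0); last by ring.
by apply: is_meanD IH; apply: is_meanD; apply: is_meanZ; exact: is_mean_cos.
Qed.

(** Orthogonality: a cross product of terms with disjoint spectra has no constant
term. *)
Lemma is_mean_sqr_sum (I : eqType) (r : seq I) (S : I -> set R)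
    (u : I -> R -> R[i]) (v : I -> R) :
  uniq r -> (forall i, i \in r -> trigpoly (S i) (u i)) ->
  (forall i j a, i \in r -> j \in r -> S i a -> S j a -> i = j) ->
  (forall i, i \in r -> is_mean (fun t => cmod (u i t) ^+ 2) (v i)) ->
  is_mean (fun t => cmod (\sum_(i <- r) u i t) ^+ 2) (\sum_(i <- r) v i).
Proof.
elim: r => [_ _ _ _|i r IH /= /andP[ir ur] Su Sd uv].
  rewrite big_nil (_ : (fun t => _) = (fun=> 0)); first exact: is_mean_cst.
  by apply/funext => t; rewrite big_nil cmod0 expr0n.
have rI j : j \in r -> j \in i :: r by rewrite in_cons orbC => ->.
pose T : set R := [set a | exists2 j, j \in r & S j a].
have Tr : trigpoly T (fun t => \sum_(j <- r) u j t).
  apply: trigpoly_sum => j jr; apply: (trigpolyW _ (Su _ (rI _ jr))) => a Sa.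
  by exists j.
pose w t := complex.Re (u i t * conjc (\sum_(j <- r) u j t)).
have w0 : is_mean w 0.
  pose U : set R := [set a | exists b b1 : R, [/\ S i b, T b1 & a = b - b1]].
  apply: (@is_mean_trigpoly U).
    move=> [b [c [Sb [j jr Sc] bc]]]; move: Sc; rewrite (_ : c = b); last lra.
    by move=> Sj; move: ir; rewrite (Sd i j b (mem_head _ _) (rI _ jr) Sb Sj) jr.
  have Tc : trigpoly [set a | T (- a)] (fun t => conjc (\sum_(j <- r) u j t)).
    by apply: trigpoly_conj Tr => b Tb; rewrite /= opprK.
  apply: (trigpolyM _ (Su i (mem_head _ _)) Tc) => b c Sb Tc'.
  by exists b, (- c); rewrite opprK.
have -> : (fun t => cmod (\sum_(j <- i :: r) u j t) ^+ 2)
    = (fun t => cmod (u i t) ^+ 2 + cmod (\sum_(j <- r) u j t) ^+ 2 + 2 * w t).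
  by apply/funext => t; rewrite big_cons sqr_cmodD.
rewrite big_cons -[X in is_mean _ X]addr0 -[X in is_mean _ (_ + X)](mulr0 2).
apply: is_meanD; last exact: is_meanZ.
apply: is_meanD; first by apply: uv; rewrite mem_head.
apply: IH => // [j jr|j k a jr kr|j jr]; first exact/Su/rI.
  by apply: Sd; exact: rI.
exact/uv/rI.
Qed.

Lemma parseval (mu : nat -> R) (r : seq nat) (a : nat -> R[i]) :
  injective mu -> uniq r ->
  is_mean (fun t => cmod (\sum_(k <- r) a k * ee (mu k) t) ^+ 2)
    (\sum_(k <- r) cmod (a k) ^+ 2).
Proof.
move=> mu_inj ur; apply: (@is_mean_sqr_sum _ r (fun k => [set mu k])
  (fun k t => a k * ee (mu k) t) (fun k => cmod (a k) ^+ 2)) => //.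
- by move=> k _; exact: trigpoly_term.
- by move=> k l _ _ _ -> /mu_inj.
move=> k _; rewrite (_ : (fun t => _) = (fun=> cmod (a k) ^+ 2)).
  exact: is_mean_cst.
by apply/funext => t; rewrite cmodM cmod_ee mulr1.
Qed.

Lemma ex_is_mean_trigpoly f : trigpoly setT f ->
  exists l, is_mean (fun t => complex.Re (f t)) l.
Proof.
move=> /trigpoly_fold[c [k [Sk H]]]; exists (c + 0).
rewrite (_ : (fun t => _) = (fun t => c + complex.Re (k t))).
  apply: is_meanD; first exact: is_mean_cst.
  by apply: is_mean_trigpoly Sk; rewrite /= ltxx.
by apply/funext.
Qed.

End TrigPoly.

(** * Powers of the modulus *)
Section Powers.
Context {R : realType}.
Implicit Types (x y t p q e : R).

(** Young's inequality with second factor 1 is the tangent line inequality. *)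
Lemma powR_ge_tangent p t : 1 <= p -> 0 <= t -> 1 + p * (t - 1) <= t `^ p.
Proof.
rewrite le_eqVlt => /predU1P[<- t0|p1 t0]; first by rewrite powRr1// mul1r subrKC.
have p0 : 0 < p by apply: lt_trans p1.
have q0 : 0 < p / (p - 1) by rewrite divr_gt0// subr_gt0.
have := @conjugate_powR R t 1 p (p / (p - 1)) t0 ler01 p0 q0.
rewrite mulr1 powR1 => /(_ _) h.
have {}h : t <= t `^ p / p + 1 / (p / (p - 1)).
  by apply: h; field; rewrite !gt_eqF// subr_gt0.
have -> : 1 + p * (t - 1) = p * (t - 1 / (p / (p - 1))).
  by field; rewrite !gt_eqF// subr_gt0.
have -> : t `^ p = p * (t `^ p / p) by field; rewrite gt_eqF.
by apply: ler_wpM2l; [exact: ltW|lra].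
Qed.

(** The concave case follows from the convex one for the inverse power. *)
Lemma powR_le_tangent q t : 0 < q -> q <= 1 -> 0 <= t ->
  t `^ q <= 1 + q * (t - 1).
Proof.
move=> q0 q1 t0.
have qV1 : 1 <= q^-1 by rewrite invf_ge1.
have := @powR_ge_tangent q^-1 (t `^ q) qV1 (powR_ge0 _ _).
rewrite -powRrM divff ?gt_eqF// powRr1// => h.
have : q * (1 + q^-1 * (t `^ q - 1)) <= q * t by apply: ler_wpM2l => //; exact: ltW.
have -> : q * (1 + q^-1 * (t `^ q - 1)) = q + (t `^ q - 1) by field; rewrite gt_eqF.
lra.
Qed.

Lemma powR_lip p x y : 1 <= p -> 0 <= y -> y <= x -> x <= 1 ->
  x `^ p - y `^ p <= p * (x - y).
Proof.
move=> p1 y0 yx x1.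
have p0 : 0 < p by apply: lt_le_trans p1.
have : 0 <= x by exact: le_trans yx.
rewrite le_eqVlt => /predU1P[x0|x0].
  have -> : y = x by apply/eqP; rewrite eq_le yx -x0 y0.
  by rewrite !subrr mulr0.
have h := @powR_ge_tangent p (y / x) p1 (divr_ge0 y0 (ltW x0)).
have yE : y `^ p = x `^ p * (y / x) `^ p.
  by rewrite -powRM ?divr_ge0// ?ltW// mulrCA divff ?gt_eqF// mulr1.
have xp : x `^ p <= x.
  by rewrite -[leRHS]powRr1 ?(ltW x0)// ger_powR// x0.
have xp0 := powR_ge0 x p.
have -> : x `^ p - y `^ p = x `^ p * (1 - (y / x) `^ p) by rewrite yE; ring.
apply: (@le_trans _ _ (x `^ p * (p * (1 - y / x)))).
  by apply: ler_wpM2l => //; lra.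
have -> : p * (x - y) = x * (p * (1 - y / x)) by field; rewrite gt_eqF.
apply: ler_wpM2r => //; apply: mulr_ge0; first exact: ltW.
by rewrite subr_ge0 ler_pdivrMr// mul1r.
Qed.

(** With [p >= 1], [x^p] is Lipschitz on the unit interval, and the square root
is Hoelder of exponent 1/2; so the increment is at most [p d] with [d^4] at
most [(y - x)^2]. *)
Lemma sqrt_powR_modulus p : 1 <= p -> forall e, 0 < e ->
  exists2 K : R, 0 <= K & forall x y, 0 <= x <= 1 -> 0 <= y <= 1 ->
    `|Num.sqrt y `^ p - Num.sqrt x `^ p| <= e + K * (y - x) ^+ 2.
Proof.
move=> p1 e e0; have p0 : 0 < p by apply: lt_le_trans p1.
pose K : R := p ^+ 4 / e ^+ 3.
have K0 : 0 <= K by rewrite divr_ge0// exprn_ge0// ltW.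
exists K => //.
suff H x y : 0 <= x -> x <= y -> y <= 1 ->
    Num.sqrt y `^ p - Num.sqrt x `^ p <= e + K * (y - x) ^+ 2.
  move=> x y /andP[x0 x1] /andP[y0 y1]; have [xy|yx] := leP x y.
    rewrite ger0_norm ?H// subr_ge0 ge0_ler_powR ?nnegrE ?sqrtr_ge0//.
      exact: ltW.
    exact: ler_wsqrtr.
  have -> : (y - x) ^+ 2 = (x - y) ^+ 2 by ring.
  rewrite distrC ger0_norm ?H// ?(ltW yx)// subr_ge0.
  rewrite ge0_ler_powR ?nnegrE ?sqrtr_ge0//; first exact: ltW.
  by apply: ler_wsqrtr; exact: ltW.
move=> x0 xy y1.
have y0 : 0 <= y by exact: le_trans xy.
have sxy : Num.sqrt x <= Num.sqrt y by exact: ler_wsqrtr.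
have sy1 : Num.sqrt y <= 1 by rewrite -sqrtr1; exact: ler_wsqrtr.
apply: le_trans (powR_lip p1 (sqrtr_ge0 x) sxy sy1) _.
rewrite -[X in (X - x) ^+ 2](sqr_sqrtr y0) -[X in (_ - X) ^+ 2](sqr_sqrtr x0).
have := sqrtr_ge0 x; move: sxy.
move: (Num.sqrt x) (Num.sqrt y) => u v uv u0.
set d := v - u.
have d0 : 0 <= d by rewrite subr_ge0.
have d4 : d ^+ 4 <= (v ^+ 2 - u ^+ 2) ^+ 2.
  have -> : d ^+ 4 = (d ^+ 2) ^+ 2 by ring.
  have d2 : 0 <= d ^+ 2 by exact: sqr_ge0.
  have : d ^+ 2 <= v ^+ 2 - u ^+ 2 by rewrite /d; nra.
  by move=> ?; rewrite ler_pXn2r// nnegrE//; lra.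
apply: (@le_trans _ _ (e + K * d ^+ 4)); last by rewrite lerD2l ler_wpM2l.
have [de|ed] := leP (p * d) e.
  by rewrite ler_wpDr// mulr_ge0// exprn_ge0.
have -> : K * d ^+ 4 = p * d * ((p * d / e) ^+ 3).
  by rewrite /K; field; rewrite gt_eqF.
apply: ler_wpDl; first exact: ltW.
rewrite ler_peMr//; first by rewrite mulr_ge0// ltW.
by rewrite exprn_ege1// ler_pdivlMr// mul1r ltW.
Qed.

End Powers.

Section MeanPowers.
Context {R : realType}.
Implicit Types (u v : R -> R) (f F : R -> R[i]).

(** Real parts of trigonometric polynomials form a ring, since the product of
[Re z] and [Re w] is the real part of [z (w + conj w) / 2]. *)
Definition rtrig u : Prop :=
  exists2 F, trigpoly setT F & u = (fun t => complex.Re (F t)).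

Lemma rtrig_cst (c : R) : rtrig (fun=> c).
Proof. by exists (fun=> c%:C) => //; exact: trigpoly_cst. Qed.

Lemma rtrigD u v : rtrig u -> rtrig v -> rtrig (fun t => u t + v t).
Proof.
move=> [F SF ->] [G SG ->]; exists (fun t => F t + G t); first exact: trigpolyD.
by apply/funext => t; rewrite ReD.
Qed.

Lemma rtrigM u v : rtrig u -> rtrig v -> rtrig (fun t => u t * v t).
Proof.
move=> [F SF ->] [G SG ->].
exists (fun t => (2^-1)%:C * (F t * (G t + conjc (G t)))).
  apply: trigpolyZ; apply: (@trigpolyM _ setT setT) => //; apply: trigpolyD => //.
  exact: trigpoly_conj SG.
by apply/funext => t; exact: Re_mulJ.
Qed.

Lemma rtrig_sqr_cmod S f : trigpoly S f -> rtrig (fun t => cmod (f t) ^+ 2).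
Proof.
move=> Sf; have Tf : trigpoly setT f by exact: trigpolyW Sf.
exists (fun t => f t * conjc (f t)).
  by apply: (@trigpolyM _ setT setT) => //; exact: trigpoly_conj Tf.
by apply/funext => t; exact: sqr_cmodE.
Qed.

Lemma rtrig_bern n phi u : rtrig u -> rtrig (fun t => bern n phi (u t)).
Proof.
move=> Tu; elim: n phi => [|n IH] phi /=; first exact: rtrig_cst.
apply: rtrigD; apply: rtrigM => //; apply: rtrigD; first exact: rtrig_cst.
rewrite (_ : (fun t => _) = (fun t => (- 1) * u t)).
  by apply: rtrigM => //; exact: rtrig_cst.
by apply/funext => t; rewrite mulN1r.
Qed.

Lemma ex_is_mean_rtrig u : rtrig u -> exists l, is_mean u l.
Proof. by move=> [F SF ->]; exact: ex_is_mean_trigpoly. Qed.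

(** Weierstrass approximation, applied to the trigonometric polynomial
[|f|^2] and the function [x^(p/2)]. *)
Lemma approx_powR_cmod S f (p e : R) : trigpoly S f -> 1 <= p -> 0 < e ->
  exists2 u, rtrig u & forall t, `|cmod (f t) `^ p - u t| <= e.
Proof.
move=> Sf p1 e0; have [B B0 HB] := trigpoly_bounded Sf.
have Bp0 : 0 < B `^ p by exact: powR_gt0.
have [|n [phi H]] := @bern_approx R (fun x => Num.sqrt x `^ p)
  (sqrt_powR_modulus p1) (e / B `^ p); first exact: divr_gt0.
exists (fun t => B `^ p * bern n phi (B ^- 2 * cmod (f t) ^+ 2)).
  apply: rtrigM; first exact: rtrig_cst.
  apply: rtrig_bern; apply: rtrigM; first exact: rtrig_cst.
  exact: rtrig_sqr_cmod Sf.
move=> t; have := H (B ^- 2 * cmod (f t) ^+ 2) _.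
have f0 := cmod_ge0 (f t).
have -> : B ^- 2 * cmod (f t) ^+ 2 = (cmod (f t) / B) ^+ 2.
  by rewrite exprMn exprVn mulrC.
have fB0 : 0 <= cmod (f t) / B by rewrite divr_ge0// ltW.
rewrite sqrtr_sqr (ger0_norm fB0) distrC => h.
have fE : cmod (f t) `^ p = B `^ p * (cmod (f t) / B) `^ p.
  by rewrite -powRM// ?ltW// mulrCA divff ?gt_eqF// mulr1.
rewrite fE -mulrBr normrM (ger0_norm (ltW Bp0)).
rewrite mulrC -ler_pdivlMr//; apply: h; rewrite sqr_ge0 expr_le1//.
by rewrite ler_pdivrMr// mul1r HB.
Qed.

Lemma ex_is_mean_powR_cmod S f (p : R) : trigpoly S f -> 1 <= p ->
  exists l, is_mean (fun t => cmod (f t) `^ p) l.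
Proof.
move=> Sf p1; apply: is_mean_uniform => e e0.
have [u Tu Hu] := approx_powR_cmod Sf p1 e0.
by have [l ul] := ex_is_mean_rtrig Tu; exists u, l.
Qed.

End MeanPowers.

(** * A lower bound of Littlewood type for mean values *)
Section OuterMultiplier.
Context {R : realType}.
Implicit Types (f g h : R -> R[i]) (m : R).

Let nonpos : set R := [set m | m <= 0].

Lemma trigpolyX (S : set R) f n : S 0 -> (forall a b, S a -> S b -> S (a + b)) ->
  trigpoly S f -> trigpoly S (fun t => f t ^+ n).
Proof.
move=> S0 SD Sf; elim: n => [|n IH].
  by rewrite (_ : (fun t => _) = (fun=> 1))//; exact: trigpoly_cst.
rewrite (_ : (fun t => _) = (fun t => f t * f t ^+ n)).
  exact: trigpolyM SD Sf IH.
by apply/funext => t; rewrite exprS.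
Qed.

(** The partial sums of the geometric series of [q = (K - h) / (1 + K)], for
which [(1 + K) (1 - q) = 1 + h], approximate the inverse of [1 + h]; the
point of using them is that they are trigonometric polynomials whose spectrum
is as one-sided as that of [h]. *)
Lemma trigpoly_inv1D h (tau : R) : trigpoly nonpos h ->
  (forall t, 0 <= complex.Re (h t)) -> 0 < tau ->
  exists2 E, trigpoly nonpos E &
    forall t, cmod (1 - E t * (1 + h t)) <= tau.
Proof.
move=> Sh h0 tau0; have [H H0 HH] := trigpoly_bounded Sh.
pose K := H ^+ 2; have K0 : 0 < K by exact: exprn_gt0.
pose q t := ((1 + K)^-1)%:C * (K%:C + - 1 * h t).
have nonposD a b : nonpos a -> nonpos b -> nonpos (a + b).
  by rewrite /nonpos /=; lra.
have nonpos0 : nonpos 0 by rewrite /nonpos /= lexx.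
have Sq : trigpoly nonpos q.
  apply: trigpolyZ; apply: trigpolyD; first exact: trigpoly_cst.
  exact: trigpolyZ.
pose rho := K / (1 + K).
have rho0 : 0 <= rho by rewrite divr_ge0//; lra.
have rho1 : rho < 1 by rewrite ltr_pdivrMr; lra.
have qrho t : cmod (q t) ^+ 2 <= rho.
  rewrite /q cmodM exprMn cmodC real_normK ?num_real// sqr_cmod.
  have := HH t; have := h0 t; have := sqr_cmod (h t); have := cmod_ge0 (h t).
  move: (cmod (h t)) => c; case: (h t) => a b /= c0 cE a0 cH.
  have cH2 : c ^+ 2 <= K by rewrite ler_pXn2r// nnegrE// ltW.
  have -> : rho = (1 + K)^-1 ^+ 2 * (K * (1 + K)).
    by rewrite /rho; field; rewrite gt_eqF//; lra.
  apply: ler_wpM2l; first exact: sqr_ge0.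
  have Ka : 0 <= K * a by rewrite mulr_ge0// ltW.
  nra.
have [n Hn] : exists n, rho ^+ n <= tau ^+ 2.
  have /cvgrPdist_le/(_ (tau ^+ 2)) : rho ^+ n @[n --> \oo] --> 0.
    by apply: cvg_expr; rewrite ger0_norm.
  move=> /(_ (exprn_gt0 _ tau0))[n _ /(_ n (leqnn n))] /=.
  by rewrite sub0r normrN ger0_norm ?exprn_ge0// => ?; exists n.
exists (fun t => ((1 + K)^-1)%:C * \sum_(i < n) q t ^+ i).
  apply: trigpolyZ.
  rewrite (_ : (fun t => _) = (fun t => \sum_(i <- index_enum 'I_n) q t ^+ i))//.
  by apply: trigpoly_sum => i _; exact: trigpolyX.
move=> t.
have -> : 1 + h t = (1 + K)%:C * (1 - q t).
  rewrite /q; case: (h t) => a b; apply/eqP; rewrite eq_complex /=.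
  by apply/andP; split; apply/eqP; field; rewrite gt_eqF//; lra.
have KV : ((1 + K)^-1)%:C * (1 + K)%:C = 1 :> R[i].
  by rewrite -rmorphM /= mulVf// gt_eqF//; lra.
rewrite (_ : _ * _ = (((1 + K)^-1)%:C * (1 + K)%:C)
  * ((1 - q t) * \sum_(i < n) q t ^+ i)); last by ring.
have -> : (1 - q t) * \sum_(i < n) q t ^+ i = 1 - q t ^+ n.
  by rewrite -[1 - q t]opprB mulNr -subrX1 opprB.
rewrite KV mul1r opprB addrC subrK.
rewrite -(@ler_pXn2r _ 2) ?nnegrE ?cmod_ge0 ?(ltW tau0)//.
apply: le_trans Hn; elim: n => [|n IH]; first by rewrite !expr0 cmod1 expr1n.
by rewrite (exprS (q t)) (exprS rho) cmodM (exprMn 2) ler_pM ?sqr_ge0.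
Qed.

(** The model is [E = 1 / (1 + h)], where [h] has nonpositive spectrum and real
part slightly above [|g|]: then [|1 + h| >= 1 + |g|], and [|1 - E| <= |h|].
Folding the spectrum of a real trigonometric polynomial [w] close to [|g|]
produces such an [h] with [Re h = w], and the mean of [|h|^2] is at most twice
that of [w^2] because the mean of [Re h^2] is a square.  The gap between [w] and
[|g|] absorbs the error made in replacing the inverse by a polynomial. *)
Lemma outer_multiplier g (m : R) : trigpoly setT g -> 0 < m ->
  is_mean (fun t => cmod (g t) ^+ 2) m ->
  exists E, [/\ trigpoly nonpos E,
    forall t, cmod (E t) * (1 + cmod (g t)) <= 1 &
    exists2 v, is_mean (fun t => cmod (1 - E t) ^+ 2) v & v <= 42 * m].
Proof.
move=> Tg m0 gm.
pose d := Num.min 1 m.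
have d0 : 0 < d by rewrite lt_min ltr01.
have dm : d ^+ 2 <= m.
  rewrite expr2; apply: (@le_trans _ _ (1 * m)); last by rewrite mul1r.
  by apply: ler_pM; rewrite ?(ltW d0)// ge_min lexx ?orbT.
have [w Tw Hw] : exists2 w, rtrig w &
    forall t, cmod (g t) + d <= w t /\ w t <= cmod (g t) + 2 * d.
  have [|u Tu Hu] := @approx_powR_cmod R _ g 1 (d / 2) Tg (lexx 1).
    exact: divr_gt0.
  exists (fun t => u t + 3 / 2 * d); first exact/rtrigD/rtrig_cst.
  move=> t; have := Hu t; rewrite powRr1 ?cmod_ge0// ler_norml => /andP[? ?].
  by split; lra.
have [F SF wF] := Tw.
have [c [k [Sk Fk]]] := trigpoly_fold SF.
pose h t := c%:C + k t.
have Sh : trigpoly nonpos h.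
  apply: trigpolyD; first by apply: trigpoly_cst; rewrite /nonpos /= lexx.
  by apply: trigpolyW Sk => x; rewrite /nonpos /=; exact: ltW.
have Reh t : complex.Re (h t) = w t by rewrite wF Fk ReD.
have [B B0 HB] := trigpoly_bounded Tg.
pose tau := d / (1 + B).
have tau0 : 0 < tau by rewrite divr_gt0//; lra.
have [|E SE HE] := trigpoly_inv1D Sh _ tau0.
  by move=> t; rewrite Reh; have [? _] := Hw t; have := cmod_ge0 (g t); lra.
have h1 t : 1 + w t <= cmod (1 + h t).
  by rewrite -Reh; apply: le_trans (ler_Re_cmod _); rewrite [leRHS]ReD.
exists E; split => //.
  move=> t; have [wg _] := Hw t; have g0 := cmod_ge0 (g t).
  have Eh : cmod (E t) * cmod (1 + h t) <= 1 + tau.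
    rewrite -cmodM (_ : _ * _ = 1 + - (1 - E t * (1 + h t))); last by ring.
    by apply: le_trans (ler_cmodD _ _) _; rewrite cmod1 cmodN lerD2l.
  have tauB : tau * (1 + cmod (g t)) <= d.
    rewrite /tau mulrAC ler_pdivrMr; last lra.
    by rewrite ler_pM2l// lerD2l.
  have E0 := cmod_ge0 (E t); have := h1 t => h1t.
  have {}Eh : cmod (E t) * (1 + cmod (g t) + d) <= 1 + tau.
    by apply: le_trans Eh; apply: ler_wpM2l => //; lra.
  have H1 : 0 < 1 + cmod (g t) + d by lra.
  rewrite -(ler_pM2r H1) mul1r mulrAC.
  apply: (@le_trans _ _ ((1 + tau) * (1 + cmod (g t)))).
    by apply: ler_wpM2r => //; lra.
  lra.
have TE : trigpoly setT (fun t => 1 + - 1 * E t).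
  apply: trigpolyD; first exact: trigpoly_cst.
  by apply: trigpolyZ; exact: trigpolyW SE.
have [v vE] := ex_is_mean_rtrig (rtrig_sqr_cmod TE).
have EE : (fun t => cmod (1 + - 1 * E t) ^+ 2) = (fun t => cmod (1 - E t) ^+ 2).
  by apply/funext => t; rewrite mulN1r.
rewrite EE in vE; exists v => //.
have SL : trigpoly [set x : R | x < 0] (fun t => (2 * c)%:C * k t + k t * k t).
  apply: trigpolyD; first exact: trigpolyZ.
  by apply: (trigpolyM _ Sk Sk) => a b /=; lra.
have L0 : ~ [set x : R | x < 0] 0 by rewrite /= ltxx.
have := is_mean_trigpoly L0 SL; set L := (fun t => complex.Re _) => Lm.
have U := is_meanD (is_meanD (is_meanZ 8 gm) (is_mean_cst (34 * d ^+ 2)))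
  (is_meanZ (- 2) Lm).
apply: (@le_trans _ _ (8 * m + 34 * d ^+ 2 + - 2 * 0)); last lra.
apply: is_mean_le vE U _ => t.
have [wg gw] := Hw t; have g0 := cmod_ge0 (g t).
have h1t : 1 <= cmod (1 + h t) by have := h1 t; lra.
have hE : cmod (1 - E t) <= cmod (h t) + tau.
  apply: (@le_trans _ _ (cmod (1 - E t) * cmod (1 + h t))).
    by rewrite ler_peMr// cmod_ge0.
  rewrite -cmodM (_ : _ * _ = h t + (1 - E t * (1 + h t))); last by ring.
  by apply: le_trans (ler_cmodD _ _) _; rewrite lerD2l.
have taud : tau <= d.
  by rewrite /tau ler_pdivrMr ?ler_peMr//; lra.
have := cmod_ge0 (1 - E t) => E0; have hh0 := cmod_ge0 (h t).
(* |h|^2 = 2 (Re h)^2 - Re h^2, and the mean of Re h^2 is c^2. *)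
have hsq : cmod (h t) ^+ 2 = 2 * w t ^+ 2 - (c ^+ 2 + L t).
  rewrite sqr_cmod -Reh /L /h; case: (k t) => a b /=; ring.
have : cmod (1 - E t) ^+ 2 <= 2 * cmod (h t) ^+ 2 + 2 * d ^+ 2.
  apply: (@le_trans _ _ ((cmod (h t) + d) ^+ 2)).
    by rewrite ler_pXn2r// ?nnegrE; lra.
  by have := sqr_ge0 (cmod (h t) - d); lra.
have : w t ^+ 2 <= 2 * cmod (g t) ^+ 2 + 8 * d ^+ 2.
  apply: (@le_trans _ _ ((cmod (g t) + 2 * d) ^+ 2)).
    by rewrite ler_pXn2r// ?nnegrE; lra.
  by have := sqr_ge0 (cmod (g t) - 2 * d); lra.
have := sqr_ge0 c; rewrite hsq; lra.
Qed.

End OuterMultiplier.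

Section Littlewood.
Context {R : realType}.
Implicit Types (S : set R) (f : R -> R[i]).

Lemma trigpoly_prod S (I : eqType) (r : seq I) (F : I -> R -> R[i]) :
  S 0 -> (forall a b, S a -> S b -> S (a + b)) ->
  (forall i, i \in r -> trigpoly S (F i)) ->
  trigpoly S (fun t => \prod_(i <- r) F i t).
Proof.
move=> S0 SD; elim: r => [_|i r IH H].
  rewrite (_ : (fun t => _) = (fun=> 1)); first exact: trigpoly_cst.
  by apply/funext => t; rewrite big_nil.
rewrite (_ : (fun t => _) = (fun t => F i t * \prod_(j <- r) F j t)); last first.
  by apply/funext => t; rewrite big_cons.
apply: (trigpolyM SD); first by apply: H; rewrite mem_head.
by apply: IH => j jr; apply: H; rewrite in_cons jr orbT.
Qed.

Lemma ex_is_mean_sqr_cmod1B S f : trigpoly S f ->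
  exists v, is_mean (fun t => cmod (1 - f t) ^+ 2) v.
Proof.
move=> Sf; apply: ex_is_mean_rtrig.
rewrite (_ : (fun t => _) = (fun t => cmod (1 + - 1 * f t) ^+ 2)).
  apply: (@rtrig_sqr_cmod _ setT); apply: trigpolyD; first exact: trigpoly_cst.
  by apply: trigpolyZ; exact: trigpolyW Sf.
by apply/funext => t; rewrite mulN1r.
Qed.

Variables (J : nat) (P : nat -> R -> R[i]) (Lam : nat -> set R).
Hypothesis HP : forall j, (j <= J)%N -> trigpoly (Lam j) (P j).
Hypothesis Lam_dec : forall i j a b, (i < j)%N -> Lam i a -> Lam j b -> b < a.
Hypothesis P_sup : forall j, (j < J)%N -> forall t, cmod (P j t) <= 4 ^+ j.
Hypothesis P_ms : forall j, (j < J)%N ->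
  is_mean (fun t => cmod (P j t) ^+ 2) (4 ^+ j).

Let g j t : R[i] := (4^-1 ^+ j)%:C * conjc (P j t).

Let nonpos : set R := [set m | m <= 0].

Let Low j : set R := [set a | exists2 i, (i < j)%N & Lam i a].

Let NLam j : set R := [set a | Lam j (- a)].

Let Tg j : (j <= J)%N -> trigpoly (NLam j) (g j).
Proof.
move=> jJ; apply: trigpolyZ; apply: trigpoly_conj (HP jJ) => m Sm.
by rewrite /NLam /= opprK.
Qed.

Let TQ j : (j <= J.+1)%N -> trigpoly (Low j) (fun t => \sum_(0 <= i < j) P i t).
Proof.
move=> jJ; apply: trigpoly_sum => i; rewrite mem_index_iota => /andP[_ ij].
apply: trigpolyW (HP (leq_trans ij jJ)) => a La; by exists i.
Qed.

Let four_gt0 j : 0 < 4 ^+ j :> R.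
Proof. by rewrite exprn_gt0. Qed.

Let fourV_gt0 j : 0 < 4^-1 ^+ j :> R.
Proof. by rewrite exprn_gt0. Qed.

Let fourVK j : 4^-1 ^+ j * 4 ^+ j = 1 :> R.
Proof. by rewrite -exprMn mulVf// expr1n. Qed.

Let cross j : (j <= J)%N ->
  is_mean (fun t => complex.Re ((\sum_(0 <= i < j) P i t) * g j t)) 0.
Proof.
move=> jJ; have := trigpolyM _ (TQ (leqW jJ)) (Tg jJ).
move=> /(_ [set a | 0 < a])h; apply: is_mean_trigpoly (h _); first by rewrite /= ltxx.
by move=> a b [i ij La] Lb /=; have := Lam_dec ij La Lb; lra.
Qed.

Let Q_ms j : (j <= J)%N -> exists2 v,
  is_mean (fun t => cmod (\sum_(0 <= i < j) P i t) ^+ 2) v & 3 * v <= 4 ^+ j.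
Proof.
move=> jJ; exists (\sum_(0 <= i < j) 4 ^+ i); last first.
  elim: j {jJ} => [|j IH]; first by rewrite big_geq// mulr0 ltW.
  by rewrite big_nat_recr//= exprS; lra.
have iJ i : i \in index_iota 0 j -> (i < J)%N.
  by rewrite mem_index_iota => /andP[_ /leq_trans]; exact.
apply: (is_mean_sqr_sum (iota_uniq _ _)) => [i /iJ/ltnW/HP|i k a _ _ Si Sk|i /iJ].
- exact.
- have [ik|ki|//] := ltngtP i k.
    by have := Lam_dec ik Si Sk; rewrite ltxx.
  by have := Lam_dec ki Sk Si; rewrite ltxx.
- exact: P_ms.
Qed.

Let gE j t : cmod (g j t) = 4^-1 ^+ j * cmod (P j t).
Proof. by rewrite /g cmodM cmodC cmod_conj ger0_norm// ltW. Qed.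

Let g_sup j t : (j < J)%N -> cmod (g j t) <= 1.
Proof. by move=> jJ; rewrite gE -[leRHS](fourVK j) ler_pM2l// P_sup. Qed.

Let g_ms j : (j < J)%N -> is_mean (fun t => cmod (g j t) ^+ 2) (4^-1 ^+ j).
Proof.
move=> jJ.
rewrite (_ : (fun t => _)
  = (fun t => (4^-1 ^+ j) ^+ 2 * cmod (P j t) ^+ 2)); last first.
  by apply/funext => t; rewrite gE exprMn.
rewrite [X in is_mean _ X](_ : 4^-1 ^+ j = (4^-1 ^+ j) ^+ 2 * 4 ^+ j); first exact/is_meanZ/P_ms.
by rewrite expr2 -mulrA fourVK mulr1.
Qed.

Let ex_E : exists E : nat -> R -> R[i], forall j, (j < J)%N ->
  [/\ trigpoly nonpos (E j),
    forall t, cmod (E j t) * (1 + 32^-1 * cmod (g j t)) <= 1 &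
    exists2 v, is_mean (fun t => cmod (1 - E j t) ^+ 2) v &
      v <= 24^-1 * 4^-1 ^+ j].
Proof.
suff /choice[E HE] : forall j, exists E : R -> R[i], (j < J)%N ->
  [/\ trigpoly nonpos E,
    forall t, cmod (E t) * (1 + 32^-1 * cmod (g j t)) <= 1 &
    exists2 v, is_mean (fun t => cmod (1 - E t) ^+ 2) v &
      v <= 24^-1 * 4^-1 ^+ j] by exists E.
move=> j; have [jJ|] := ltnP j J; last by exists (fun=> 0).
have Hg : (fun t => cmod ((32^-1)%:C * g j t) ^+ 2)
    = (fun t => 32^-1 ^+ 2 * cmod (g j t) ^+ 2).
  by apply/funext => t; rewrite cmodM cmodC exprMn ger0_norm.
have [|||E [SE EB [v Ev vle]]] := @outer_multiplier R
    (fun t => (32^-1)%:C * g j t) (32^-1 ^+ 2 * 4^-1 ^+ j).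
- by apply: trigpolyZ; apply: trigpolyW (Tg (ltnW jJ)).
- by rewrite mulr_gt0// exprn_gt0.
- by rewrite Hg; apply: is_meanZ; exact: g_ms.
exists E => _; split => //.
  by move=> t; have := EB t; rewrite cmodM cmodC ger0_norm.
exists v => //; apply: le_trans vle _.
have := fourV_gt0 j; set x := 4^-1 ^+ j => x0.
by rewrite mulrA ler_pM2r//; lra.
Qed.

(** The test function is the sum of the [g j * W j J], with [W j n] the product
of the multipliers of indices strictly between [j] and [n]. *)
Theorem littlewood_blocks (l : R) :
  is_mean (fun t => cmod (\sum_(0 <= j < J.+1) P j t)) l -> J%:R / 2 <= 33 * l.
Proof.
have [E HE] := ex_E; move=> fl.
pose W j n t : R[i] := \prod_(j.+1 <= i < n) E i t.
have nonposD a b : nonpos a -> nonpos b -> nonpos (a + b).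
  by rewrite /nonpos /=; lra.
have nonpos0 : nonpos 0 by rewrite /nonpos /= lexx.
have TW j : trigpoly nonpos (W j J).
  apply: trigpoly_prod => // i; rewrite mem_index_iota => /andP[_ iJ].
  by have [] := HE i iJ.
have E1 j t : (j < J)%N -> cmod (E j t) <= 1.
  move=> jJ; have [_ /(_ t) h _] := HE j jJ; apply: le_trans h.
  by rewrite ler_peMr ?cmod_ge0// lerDl mulr_ge0// cmod_ge0.
have W_ms j : exists2 v, is_mean (fun t => cmod (1 - W j J t) ^+ 2) v &
    v <= 24^-1 * 4^-1 ^+ j.
  have W1 i : (J <= i.+1)%N ->
    exists2 v, is_mean (fun t => cmod (1 - W i J t) ^+ 2) v &
    v <= 24^-1 * 4^-1 ^+ i.
    move=> Ji; exists 0; last by rewrite mulr_ge0// ltW.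
    rewrite (_ : (fun t => _) = (fun=> 0)); first exact: is_mean_cst.
    by apply/funext => t; rewrite /W big_geq// subrr cmod0 expr0n.
  (* Squares of sums at most double, while the geometric bound gains a factor 4
     at each step, so the estimate propagates downwards from J. *)
  have [d] : {d | (J <= j + d)%N} by exists J; exact: leq_addl.
  elim: d j => [|d IH] j Jd; first by apply: W1; rewrite addn0 in Jd; exact: leqW.
  have [Jj|jJ] := leqP J j.+1; first exact: W1.
  have [|v' v'm v'le] := IH j.+1; first by rewrite addSnnS.
  have [_ _ [v vm vle]] := HE j.+1 jJ.
  have [u um] := ex_is_mean_sqr_cmod1B (TW j); exists u => //.
  apply: (@le_trans _ _ (2 * v + 2 * v')); last first.
    by move: vle v'le; rewrite exprS; lra.
  apply: is_mean_le um (is_meanD (is_meanZ 2 vm) (is_meanZ 2 v'm)) _ => t.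
  rewrite /W big_ltn//; set w := \prod_(_ <= i < _) _; set e := E j.+1 t.
  have e1 : cmod e <= 1 by exact: E1.
  have h : cmod (1 - e * w) <= cmod (1 - e) + cmod (1 - w).
    rewrite (_ : 1 - e * w = (1 - e) + e * (1 - w)); last by ring.
    apply: le_trans (ler_cmodD _ _) _; rewrite lerD2l cmodM.
    by rewrite ler_piMl// cmod_ge0.
  have := cmod_ge0 (1 - e); have := cmod_ge0 (1 - w); have := cmod_ge0 (1 - e * w).
  move=> h0 h1 h2.
  apply: (@le_trans _ _ ((cmod (1 - e) + cmod (1 - w)) ^+ 2)).
    by rewrite ler_pXn2r// ?nnegrE; lra.
  by have := sqr_ge0 (cmod (1 - e) - cmod (1 - w)); lra.
have G_sup n t : (n <= J)%N ->
    cmod (\sum_(0 <= j < n) g j t * W j n t) <= 33.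
  elim: n => [_|n IH nJ]; first by rewrite big_geq// cmod0.
  (* The bound b is stable under b |-> b / (1 + y / 32) + y for 0 <= y <= 1
     exactly when b >= 33. *)
  have -> : \sum_(0 <= j < n.+1) g j t * W j n.+1 t
      = (\sum_(0 <= j < n) g j t * W j n t) * E n t + g n t.
    have Wn : W n n.+1 t = 1 by rewrite /W big_geq.
    rewrite big_nat_recr//= Wn mulr1; congr (_ + _).
    rewrite big_distrl/=; apply: eq_big_nat => j /andP[_ jn].
    by rewrite /W big_nat_recr//= mulrA.
  apply: le_trans (ler_cmodD _ _) _; rewrite cmodM.
  have [_ /(_ t) h _] := HE n nJ; have g1 := g_sup t nJ.
  have := IH (ltnW nJ); set b := cmod _ => b33.
  move: h g1 (cmod_ge0 (g n t)) (cmod_ge0 (E n t)).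
  set y := cmod (g n t); set e := cmod (E n t) => h y1 y0 e0.
  have be : b * e <= 33 * e by exact: ler_wpM2r.
  have y2 : y * y <= y by rewrite ler_piMl.
  have : (33 * e + y) * (1 + 32^-1 * y) <= 33 * (1 + 32^-1 * y) by nra.
  by rewrite ler_pM2r; lra.
pose f t := \sum_(0 <= j < J.+1) P j t.
have Tf : trigpoly setT f.
  apply: trigpoly_sum => i; rewrite mem_index_iota ltnS => /andP[_ iJ].
  exact: trigpolyW (HP iJ).
have fgW j : (j < J)%N -> exists2 v,
    is_mean (fun t => complex.Re (f t * (g j t * W j J t))) v & 2^-1 <= v.
  move=> jJ.
  have [v vm] : exists v, is_mean (fun t => complex.Re (f t * (g j t * W j J t))) v.
    apply: ex_is_mean_trigpoly; apply: (@trigpolyM _ setT setT) => //.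
    apply: (@trigpolyM _ setT setT) => //; first exact: trigpolyW (Tg (ltnW jJ)).
    exact: trigpolyW (TW j).
  exists v => //.
  pose tail t := \sum_(j.+1 <= i < J.+1) P i t.
  pose Q t := \sum_(0 <= i < j.+1) P i t.
  pose Q' t := \sum_(0 <= i < j) P i t.
  have Ttail : trigpoly [set a | exists2 i, (j < i)%N & Lam i a] tail.
    apply: trigpoly_sum => i; rewrite mem_index_iota ltnS => /andP[ji iJ].
    by apply: trigpolyW (HP iJ) => a La; exists i.
  have tail_m : is_mean (fun t => complex.Re (tail t * (g j t * W j J t))) 0.
    have T1 : trigpoly [set a | exists2 b, NLam j b & a <= b]
        (fun t => g j t * W j J t).
      by apply: (trigpolyM _ (Tg (ltnW jJ)) (TW j)) => a b La Lb; exists a => //;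
        move: Lb; rewrite /nonpos /=; lra.
    have := trigpolyM _ Ttail T1 => /(_ [set a | a < 0]) h.
    apply: is_mean_trigpoly (h _); first by rewrite /= ltxx.
    move=> a b [i ji La] [b' Lb' bb'] /=.
    by have := Lam_dec ji Lb' La; lra.
  have [q qm q4] := Q_ms jJ; have [w wm w4] := W_ms j.
  have lb := is_meanD (is_meanD (is_meanD tail_m (cross (ltnW jJ)))
    (is_meanZ (4^-1 ^+ j) (P_ms jJ)))
    (is_meanD (is_meanZ (- (8^-1 * 4^-1 ^+ j)) qm) (is_meanZ (- (2 * 4 ^+ j)) wm)).
  have : 0 + 0 + 4^-1 ^+ j * 4 ^+ j
      + (- (8^-1 * 4^-1 ^+ j) * q + - (2 * 4 ^+ j) * w) <= v.
    apply: is_mean_le lb vm _ => t.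
    rewrite [f t](_ : _ = Q t + tail t); last first.
      by rewrite /f (big_cat_nat (n := j.+1))//= ltnS ltnW.
    have QE : Q t = Q' t + P j t by rewrite /Q big_nat_recr.
    (* The tail has mean 0, and so has Q' g by separation of the blocks; the
       block itself gives 1, and the last term is an error controlled by the
       quadratic means of Q and of 1 - W. *)
    rewrite (_ : (Q t + tail t) * (g j t * W j J t)
      = tail t * (g j t * W j J t) + Q' t * g j t
        + P j t * g j t + - (Q t * g j t * (1 - W j J t))); last by rewrite QE; ring.
    rewrite !ReD -/(Q' t) -/(Q t).
    have -> : complex.Re (P j t * g j t) = 4^-1 ^+ j * cmod (P j t) ^+ 2.
      by rewrite /g mulrCA ReZ -sqr_cmodE.
    rewrite lerD2l.
    set z := Q t * g j t * _.
    have zle : complex.Re z <= cmod (Q t) * cmod (1 - W j J t).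
      apply: le_trans (ler_Re_cmod _) _; rewrite /z cmodM (cmodM (Q t)).
      rewrite ler_wpM2r ?cmod_ge0// ler_piMr ?cmod_ge0//; exact: g_sup.
    have -> : complex.Re (- z) = - complex.Re z by case: (z).
    move: zle; set x := cmod _; set y := cmod (1 - _) => zle.
    have xy : x * y <= 8^-1 * 4^-1 ^+ j * x ^+ 2 + 2 * 4 ^+ j * y ^+ 2.
      have := sqr_ge0 (x * 4^-1 ^+ j - 4 * y).
      have := fourVK j; have := four_gt0 j; have := fourV_gt0 j.
      set a := 4^-1 ^+ j; set b := 4 ^+ j => a0 b0 ab h.
      have : 0 <= b * (x * a - 4 * y) ^+ 2 by apply: mulr_ge0 => //; exact: ltW.
      have -> : b * (x * a - 4 * y) ^+ 2
        = (a * b) * (a * x ^+ 2 - 8 * (x * y)) + 16 * (b * y ^+ 2) by ring.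
      by rewrite ab; lra.
    lra.
  rewrite fourVK; have := fourVK j.
  have := four_gt0 j; have := fourV_gt0 j; move: q4 w4; rewrite exprS.
  set a := 4^-1 ^+ j; set b := 4 ^+ j => q4 w4 a0 b0 ab.
  have aq : a * q <= 3^-1 * 4.
    have : a * (3 * q) <= a * (4 * b) by apply: ler_wpM2l => //; exact: ltW.
    have -> : a * (4 * b) = 4 * (a * b) by ring.
    by rewrite ab; lra.
  have bw : b * w <= 24^-1.
    have : b * w <= b * (24^-1 * a) by apply: ler_wpM2l => //; exact: ltW.
    have -> : b * (24^-1 * a) = 24^-1 * (a * b) by ring.
    by rewrite ab; lra.
  lra.
have fG n : (n <= J)%N -> exists2 v,
    is_mean (fun t => complex.Re (f t * \sum_(0 <= j < n) g j t * W j J t)) v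
    & n%:R / 2 <= v.
  elim: n => [_|n IH nJ].
    exists 0; last by rewrite mul0r.
    rewrite (_ : (fun t => _) = (fun=> 0)); first exact: is_mean_cst.
    by apply/funext => t; rewrite big_geq// mulr0.
  have [v vm vle] := IH (ltnW nJ); have [u um ule] := fgW n nJ.
  exists (v + u); last by rewrite -natr1; lra.
  rewrite (_ : (fun t => _) = (fun t =>
    complex.Re (f t * \sum_(0 <= j < n) g j t * W j J t)
    + complex.Re (f t * (g n t * W n J t)))); first exact: is_meanD.
  by apply/funext => t; rewrite big_nat_recr//= mulrDr ReD.
have [v vm vle] := fG J (leqnn J); apply: le_trans vle _.
apply: is_mean_le vm (is_meanZ 33 fl) _ => t.
apply: le_trans (ler_Re_cmod _) _; rewrite cmodM mulrC.
by apply: ler_wpM2r; [exact: cmod_ge0|exact: G_sup].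
Qed.

End Littlewood.

(** * Even moments of sparse exponential sums *)
Section SparseMoments.
Context {R : realType}.
Implicit Types (f : R -> R[i]) (M x : R).

Lemma eeX x t n : ee x t ^+ n = ee (n%:R * x) t :> R[i].
Proof.
elim: n => [|n IH]; first by rewrite mul0r ee0.
by rewrite exprS IH -eeD -natr1; congr ee; ring.
Qed.

Lemma trigpolyX_itv f M n : trigpoly [set a | - M <= a <= 0] f ->
  trigpoly [set a | - (n%:R * M) <= a <= 0] (fun t => f t ^+ n).
Proof.
move=> Sf; elim: n => [|n IH].
  rewrite (_ : (fun t => _) = (fun=> 1)) //; apply: trigpoly_cst.
  by rewrite /= mul0r oppr0 lexx.
rewrite (_ : (fun t => _) = (fun t => f t * f t ^+ n)).
  apply: trigpolyM Sf IH => a b /= /andP[? ?] /andP[? ?].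
  by rewrite -natr1 mulrDl mul1r; apply/andP; split; lra.
by apply/funext => t; rewrite exprS.
Qed.

Variables (k : nat) (mu : nat -> R).
Hypothesis mu_gt0 : forall N, 0 < mu N.
Hypothesis mu_sparse : forall i N, (i < N)%N -> k.+1%:R * mu i <= mu N.

(** Expand the [j]-th power of the sum of [N + 1] terms by the binomial formula
in the last exponential: its frequency is so large that the binomial terms have
disjoint spectra.  Hence the moments satisfy a recursion, which the bound
[j! N^j] solves because ['C(j, i) * (j - i)! <= j!]. *)
Theorem moment_sparse N : exists v : nat -> R, forall j, (j <= k)%N ->
  is_mean (fun t => cmod (\sum_(0 <= i < N) ee (- mu i) t) ^+ j.*2) (v j) /\
  v j <= j`!%:R * N%:R ^+ j.
Proof.
elim: N => [|N [v IH]].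
  exists (fun j => 0 ^+ j) => j jk; split.
    rewrite (_ : (fun t => _) = (fun=> 0 ^+ j)); first exact: is_mean_cst.
    by apply/funext => t; rewrite big_geq// cmod0 -mul2n exprM (expr0n _ 2).
  by case: j {jk} => [|j]; rewrite ?expr0 ?mul1r// !expr0n /= mulr0.
pose f t : R[i] := \sum_(0 <= i < N) ee (- mu i) t.
pose u j (i : 'I_j.+1) t := f t ^+ (j - i) * ee (- mu N) t ^+ i *+ 'C(j, i).
pose w j (i : 'I_j.+1) := ('C(j, i)%:R ^+ 2) * v (j - i)%N.
exists (fun j => \sum_(i < j.+1) w j i) => j jk; split.
  rewrite (_ : (fun t => _) = (fun t => cmod (\sum_(i < j.+1) u j i t) ^+ 2)).
    (* M bounds the frequencies of f, and k M is still below that of index N. *)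
    pose M := mu N / k.+1%:R.
    have M0 : 0 <= M by rewrite divr_ge0// ltW.
    have kM : k%:R * M < mu N.
      by rewrite /M mulrA ltr_pdivrMr// mulrC ltr_pM2l// ltr_nat.
    have Sf : trigpoly [set a | - M <= a <= 0] f.
      apply: trigpoly_sum => i; rewrite mem_index_iota => /andP[_ iN].
      rewrite (_ : ee _ = fun t => 1 * ee (- mu i) t).
        apply: trigpoly_term; rewrite /= lerN2 oppr_le0 (ltW (mu_gt0 i)) andbT.
        by rewrite /M ler_pdivlMr// mulrC mu_sparse.
      by apply/funext => t; rewrite mul1r.
    apply: (@is_mean_sqr_sum _ _ _ (fun i : 'I_j.+1 =>
        [set a | - (k%:R * M) - i%:R * mu N <= a <= - (i%:R * mu N)])
        (u j) (w j)).
    - exact: index_enum_uniq.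
    - move=> i _; rewrite (_ : u j i = fun t => f t ^+ (j - i)
          * (('C(j, i)%:R)%:C * ee (i%:R * - mu N) t)); last first.
        by apply/funext => t; rewrite /u eeX rmorph_nat [RHS]mulrCA [RHS]mulr_natl.
      apply: (trigpolyM _ (trigpolyX_itv (j - i) Sf)
        (@trigpoly_term _ [set i%:R * - mu N] _ _ erefl)).
      move=> a b /= /andP[? ?] ->; rewrite mulrN.
      have : (j - i)%:R * M <= k%:R * M.
        by rewrite ler_wpM2r// ler_nat (leq_trans (leq_subr _ _)).
      by move=> ?; apply/andP; split; lra.
    - move=> i i' a _ _ /= /andP[? ?] /andP[? ?]; apply/val_inj/eqP => /=.
      have [ii'|ii'|//] := ltngtP i i'.
        have : (i.+1%:R : R) * mu N <= i'%:R * mu N.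
          by rewrite ler_pM2r// ler_nat.
        by rewrite -natr1; lra.
      have : (i'.+1%:R : R) * mu N <= i%:R * mu N.
        by rewrite ler_pM2r// ler_nat.
      by rewrite -natr1; lra.
    - move=> i _; have [vi _] := IH (j - i)%N (leq_trans (leq_subr _ _) jk).
      rewrite (_ : (fun t => _)
        = (fun t => 'C(j, i)%:R ^+ 2 * cmod (f t) ^+ (j - i).*2)).
        exact: is_meanZ.
      apply/funext => t; rewrite /u -mulr_natl cmodM exprMn eeX cmodM cmod_ee mulr1.
      congr (_ * _); last first.
        by rewrite -mul2n mulnC exprM; congr (_ ^+ 2); elim: (j - i)%N => [|n IHn];
          rewrite ?cmod1// !exprS cmodM IHn.
      by rewrite -(rmorph_nat (real_complex R)) cmodC ger0_norm.
  apply/funext => t; rewrite big_nat_recr//= -/(f t) -exprDn.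
  rewrite -mul2n mulnC exprM; congr (_ ^+ 2).
  by elim: j {jk} => [|n IHn]; rewrite ?cmod1// !exprS cmodM IHn.
rewrite -natr1 exprDn mulr_sumr; apply: ler_sum => i _.
rewrite expr1n mulr1 /w.
have [_ vi] := IH (j - i)%N (leq_trans (leq_subr _ _) jk).
rewrite -[_ ^+ _ *+ _]mulr_natl.
apply: (@le_trans _ _ ('C(j, i)%:R ^+ 2 * ((j - i)`!%:R * N%:R ^+ (j - i)))).
  by apply: ler_wpM2l => //; exact: sqr_ge0.
rewrite mulrA mulrCA mulrA ler_wpM2r ?exprn_ge0//.
have ij : (i <= j)%N by rewrite -ltnS.
rewrite -!natrX -!natrM ler_nat -(bin_fact ij) -mulnA leq_mul2l; apply/orP; right.
by rewrite leq_mul// leq_pmull// fact_gt0.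
Qed.

End SparseMoments.

(** * Norms of Dirichlet polynomials *)
Section Norms.
Context {R : realType}.
Implicit Types (p x l m : R) (A : {fset nat}) (a : nat -> R[i]) (F : R -> R).

Lemma is_mean_affine F l x m :
  is_mean F l -> is_mean (fun t => x + m * F t) (x + m * l).
Proof. by move=> Fl; apply: is_meanD; [exact: is_mean_cst|exact: is_meanZ]. Qed.

(** Monotonicity of [x |-> x^r] reduces this to comparing [u] with the powers
of the numbers near the expected limit. *)
Lemma cvg_powRV (T : Type) (G : set_system T) (u : T -> R) l r : Filter G ->
  0 < r -> 0 <= l -> (\forall s \near G, 0 <= u s) -> u s @[s --> G] --> l ->
  u s `^ r^-1 @[s --> G] --> l `^ r^-1.
Proof.
move=> FG r0 l0 u0 ul; apply/cvgrPdist_le => e e0.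
set y := l `^ r^-1.
have y0 : 0 <= y by exact: powR_ge0.
have rV0 : 0 <= r^-1 by rewrite invr_ge0 ltW.
have yr : y `^ r = l by rewrite /y -powRrM mulVf ?gt_eqF// powRr1.
have rK z : 0 <= z -> (z `^ r) `^ r^-1 = z.
  by move=> z0; rewrite -powRrM divff ?gt_eqF// powRr1.
have up : \forall s \near G, u s <= (y + e) `^ r.
  apply: (cvgr_le _ ul); rewrite -yr; apply: gt0_ltr_powR => //.
  - by rewrite nnegrE addr_ge0// ltW.
  - by rewrite ltrDl.
have lo : \forall s \near G, (Num.max 0 (y - e)) `^ r <= u s.
  have [ye|ye] := leP y e.
    near=> s; rewrite (_ : Num.max _ _ = 0); last by apply/max_idPl; lra.
    by rewrite powR0 ?gt_eqF//; near: s.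
  apply: (cvgr_ge _ ul); rewrite -yr; apply: gt0_ltr_powR => //.
  - by rewrite nnegrE le_max lexx.
  - by rewrite gt_max; apply/andP; split; lra.
near=> s.
have us0 : 0 <= u s by near: s.
have ups : u s <= (y + e) `^ r by near: s.
have los : (Num.max 0 (y - e)) `^ r <= u s by near: s.
rewrite ler_norml; apply/andP; split.
  have : u s `^ r^-1 <= ((y + e) `^ r) `^ r^-1.
    by apply: ge0_ler_powR; rewrite ?nnegrE ?powR_ge0.
  by rewrite rK; lra.
have : ((Num.max 0 (y - e)) `^ r) `^ r^-1 <= u s `^ r^-1.
  by apply: ge0_ler_powR; rewrite ?nnegrE ?powR_ge0.
rewrite rK ?le_max ?lexx// => h.
have : y - e <= Num.max 0 (y - e) by rewrite le_max lexx orbT.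
lra.
Unshelve. all: by end_near. Qed.

Variable lambda : nat -> R.

Notation D A a := (fun t : R => dirichlet_poly lambda A a (0 +i* t)).

Lemma dirichlet_line A a t :
  dirichlet_poly lambda A a (0 +i* t) = \sum_(n <- A) a n * ee (- lambda n) t.
Proof.
apply: eq_bigr => n _; congr (_ * _); rewrite /cexp /ee /=.
rewrite !mulr0 !mul0r subr0 oppr0 expR0 !mul1r.
by rewrite addr0 mulNr.
Qed.

Lemma trigpoly_dirichlet A a : trigpoly setT (D A a).
Proof.
rewrite (_ : (fun t => _) = (fun t => \sum_(n <- A) a n * ee (- lambda n) t)).
  by apply: trigpoly_sum => n _; exact: trigpoly_term.
by apply/funext => t; exact: dirichlet_line.
Qed.

Lemma HnormE p A a l : 1 <= p ->
  is_mean (fun t => cmod (dirichlet_poly lambda A a (0 +i* t)) `^ p) l ->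
  Hnorm lambda p%:E A a = (l `^ p^-1)%:E.
Proof.
move=> p1 Dl; have p0 : 0 < p by exact: lt_le_trans p1.
have l0 : 0 <= l.
  by apply: is_mean_le (is_mean_cst 0) Dl _ => t; exact: powR_ge0.
have [_ Dc] := Dl; rewrite /Hnorm; congr (_%:E).
apply: cvg_lim => //; apply: (@cvg_powRV _ _ _ l p _ p0 l0 _ Dc).
near=> T; apply: mulr_ge0.
  by rewrite invr_ge0 mulr_ge0//; near: T; exact: nbhs_pinfty_ge.
by apply: Rintegral_ge0 => t _; exact: powR_ge0.
Unshelve. all: by end_near. Qed.

Lemma ex_is_mean_dirichlet p A a : 1 <= p ->
  exists l, is_mean (fun t => cmod (dirichlet_poly lambda A a (0 +i* t)) `^ p) l.
Proof. exact/ex_is_mean_powR_cmod/trigpoly_dirichlet. Qed.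

(** For finite [p], norms are estimated through a pointwise bound on [|D|^p] by a
function of known mean; this lemma and the next do the passage. *)
Lemma Hnorm_le p A a F m x : 1 <= p -> 0 <= x -> is_mean F m ->
  (forall t, cmod (dirichlet_poly lambda A a (0 +i* t)) `^ p <= F t) ->
  m <= x `^ p -> (Hnorm lambda p%:E A a <= x%:E)%E.
Proof.
move=> p1 x0 Fm DF mx; have p0 : 0 < p by exact: lt_le_trans p1.
have [l Dl] := ex_is_mean_dirichlet A a p1.
have lm := is_mean_le Dl Fm DF.
have l0 : 0 <= l.
  by apply: is_mean_le (is_mean_cst 0) Dl _ => t; exact: powR_ge0.
rewrite (HnormE p1 Dl) lee_fin.
have -> : x = (x `^ p) `^ p^-1 by rewrite -powRrM divff ?gt_eqF// powRr1.
apply: ge0_ler_powR; rewrite ?nnegrE ?powR_ge0 ?invr_ge0//; first exact: ltW.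
exact: le_trans mx.
Qed.

Lemma Hnorm_ge p A a F m x : 1 <= p -> 0 <= x -> is_mean F m ->
  (forall t, F t <= cmod (dirichlet_poly lambda A a (0 +i* t)) `^ p) ->
  x `^ p <= m -> (x%:E <= Hnorm lambda p%:E A a)%E.
Proof.
move=> p1 x0 Fm DF mx; have p0 : 0 < p by exact: lt_le_trans p1.
have [l Dl] := ex_is_mean_dirichlet A a p1.
have lm := is_mean_le Fm Dl DF.
rewrite (HnormE p1 Dl) lee_fin.
have -> : x = (x `^ p) `^ p^-1 by rewrite -powRrM divff ?gt_eqF// powRr1.
apply: ge0_ler_powR; rewrite ?nnegrE ?powR_ge0 ?invr_ge0//; first exact: ltW.
  by apply: (le_trans _ lm); apply: le_trans mx; exact: powR_ge0.
exact: le_trans lm.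
Qed.

Lemma Hnorm_ge0 p A a : 1 <= p -> (0 <= Hnorm lambda p%:E A a)%E.
Proof.
move=> p1; have [l Dl] := ex_is_mean_dirichlet A a p1.
by rewrite (HnormE p1 Dl) lee_fin powR_ge0.
Qed.

Lemma ler_cmod_sum (I : Type) (r : seq I) (z : I -> R[i]) :
  cmod (\sum_(i <- r) z i) <= \sum_(i <- r) cmod (z i).
Proof.
elim: r => [|i r IH]; first by rewrite !big_nil cmod0.
rewrite !big_cons; apply: le_trans (ler_cmodD _ _) _.
by rewrite lerD2l.
Qed.

Section Unimodular.
Variables (A : {fset nat}) (a : nat -> R[i]).
Hypothesis a1 : unimodular A a.
Hypothesis lambda_inj : injective lambda.
Let N : R := #|` A|%:R.
Let d t : R := cmod (dirichlet_poly lambda A a (0 +i* t)).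

Let d0 t : 0 <= d t. Proof. exact: cmod_ge0. Qed.

Let sum_unimodular (q : nat) : \sum_(n <- A) cmod (a n) ^+ q = N.
Proof.
rewrite (eq_big_seq (fun=> 1)); last by move=> n nA; rewrite a1// expr1n.
by rewrite big_const_seq count_predT iter_addr_0.
Qed.

Lemma cmod_dirichlet_le t : d t <= N.
Proof.
rewrite /d dirichlet_line; apply: le_trans (ler_cmod_sum _ _) _.
rewrite -(sum_unimodular 1); apply: ler_sum => n _.
by rewrite cmodM cmod_ee mulr1.
Qed.

Lemma mean_sqr_unimodular : is_mean (fun t => d t ^+ 2) N.
Proof.
rewrite -(sum_unimodular 2).
rewrite (_ : (fun t => _) =
  (fun t => cmod (\sum_(n <- A) a n * ee (- lambda n) t) ^+ 2)).
  apply: (@parseval _ (fun n => - lambda n)); last exact: fset_uniq.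
  by move=> m n /oppr_inj/lambda_inj.
by apply/funext => t; rewrite /d dirichlet_line.
Qed.

Let Dpow p t : 0 < N ->
  d t `^ p = N `^ (p / 2) * (N^-1 * d t ^+ 2) `^ (p / 2).
Proof.
move=> N0; rewrite -powRM ?(ltW N0)//; last first.
  by rewrite mulr_ge0 ?sqr_ge0// invr_ge0 ltW.
rewrite mulrA divff ?gt_eqF// mul1r -powR_mulrn// -powRrM.
by congr (_ `^ _); field.
Qed.

Let sqrtN p : (N `^ 2^-1) `^ p = N `^ (p / 2).
Proof. by rewrite -powRrM mulrC. Qed.

Let s0 t : 0 <= N^-1 * d t ^+ 2.
Proof. by rewrite mulr_ge0 ?sqr_ge0// invr_ge0 /N. Qed.

Let s_mean : 0 < N -> is_mean (fun t => N^-1 * d t ^+ 2) 1.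
Proof.
move=> N0; rewrite -[X in is_mean _ X](mulVf (lt0r_neq0 N0)).
exact/is_meanZ/mean_sqr_unimodular.
Qed.

Let Npos_or_null : 0 < N \/ (N = 0 /\ forall t, d t = 0).
Proof.
have : 0 <= N by rewrite /N.
rewrite le_eqVlt => /predU1P[N0|N0]; [right|by left].
split=> // t; apply/eqP; rewrite eq_le d0 andbT.
by have := cmod_dirichlet_le t; rewrite -N0.
Qed.

(** The mean of [s = |D|^2 / N] is 1, so an inequality between [s^(p/2)] and its
tangent at 1 becomes one between the [p]-th moment and [N^(p/2)]. *)
Lemma Hnorm_le_sqrt p : 1 <= p -> p <= 2 ->
  (Hnorm lambda p%:E A a <= (N `^ 2^-1)%:E)%E.
Proof.
move=> p1 p2; have p0 : 0 < p by exact: lt_le_trans p1.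
have [N0|[N0 dE]] := Npos_or_null; last first.
  apply: (Hnorm_le p1 _ (is_mean_cst 0)); rewrite ?powR_ge0// => t.
  by rewrite -/(d t) dE powR0// gt_eqF.
apply: (Hnorm_le p1 (powR_ge0 _ _)
  (is_mean_affine (N `^ (p / 2) * (1 - p / 2)) (N `^ (p / 2) * (p / 2)) (s_mean N0))).
  move=> t; rewrite -/(d t) (Dpow _ _ N0) -mulrA -mulrDr ler_wpM2l ?powR_ge0//.
  have := @powR_le_tangent R (p / 2) _ _ _ (s0 t).
  by move=> /(_ _ _)h; apply: (le_trans (h _ _)); lra.
by rewrite sqrtN mulr1 -mulrDr subrK mulr1.
Qed.

Lemma Hnorm_ge_sqrt p : 0 < N -> 2 <= p ->
  ((N `^ 2^-1)%:E <= Hnorm lambda p%:E A a)%E.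
Proof.
move=> N0 p2; have p1 : 1 <= p by apply: le_trans p2; rewrite ler1n.
apply: (Hnorm_ge p1 (powR_ge0 _ _)
  (is_mean_affine (N `^ (p / 2) * (1 - p / 2)) (N `^ (p / 2) * (p / 2)) (s_mean N0))).
  move=> t; rewrite -/(d t) (Dpow _ _ N0) -mulrA -mulrDr ler_wpM2l ?powR_ge0//.
  have := @powR_ge_tangent R (p / 2) _ _ (s0 t).
  by move=> /(_ _)h; apply: (le_trans _ (h _)); lra.
by rewrite sqrtN mulr1 -mulrDr subrK mulr1.
Qed.

Let powN_conj p : 0 < p -> 0 < N -> (N `^ (1 - p^-1)) `^ p = N `^ (p - 2) * N.
Proof.
move=> p0 N0; have -> : N `^ (p - 2) * N = N `^ (p - 2) * N `^ 1.
  by rewrite powRr1// ltW.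
rewrite -powRrM -powRD; last by rewrite (gt_eqF N0) implybT.
by congr (_ `^ _); field; rewrite gt_eqF.
Qed.

(** Interpolation between the second moment and the supremum:
[N^(p-2) |D|^2 <= |D|^p] as [|D| <= N]. *)
Lemma Hnorm_ge_conj p : 0 < N -> 1 <= p -> p <= 2 ->
  ((N `^ (1 - p^-1))%:E <= Hnorm lambda p%:E A a)%E.
Proof.
move=> N0 p1 p2; have p0 : 0 < p by exact: lt_le_trans p1.
apply: (Hnorm_ge p1 (powR_ge0 _ _)
  (is_meanZ (N `^ (p - 2)) mean_sqr_unimodular)).
  move=> t; rewrite -/(d t); have := d0 t.
  rewrite le_eqVlt => /predU1P[<-|dt0]; first by rewrite expr0n mulr0 powR_ge0.
  have -> : d t ^+ 2 = d t `^ (2 - p) * d t `^ p.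
    by rewrite -powRD ?subrK ?powR_mulrn ?(ltW dt0)// (gt_eqF dt0) implybT.
  rewrite mulrA ler_piMl ?powR_ge0//.
  apply: (@le_trans _ _ (N `^ (p - 2) * N `^ (2 - p))).
    apply: ler_wpM2l; first exact: powR_ge0.
    apply: ge0_ler_powR; rewrite ?nnegrE ?subr_ge0 ?(ltW dt0) ?(ltW N0)//.
    exact: cmod_dirichlet_le.
  rewrite -powRD; last by rewrite (gt_eqF N0) implybT.
  by rewrite addrA subrK subrr powRr0.
by rewrite powN_conj.
Qed.

Lemma Hnorm_le_conj p : 2 <= p ->
  (Hnorm lambda p%:E A a <= (N `^ (1 - p^-1))%:E)%E.
Proof.
move=> p2; have p1 : 1 <= p by apply: le_trans p2; rewrite ler1n.
have p0 : 0 < p by exact: lt_le_trans p1.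
apply: (Hnorm_le p1 (powR_ge0 _ _)
  (is_meanZ (N `^ (p - 2)) mean_sqr_unimodular)).
  move=> t; rewrite -/(d t); have := d0 t.
  rewrite le_eqVlt => /predU1P[<-|dt0].
    by rewrite expr0n mulr0 powR0// gt_eqF.
  have -> : d t `^ p = d t `^ (p - 2) * d t ^+ 2.
    by rewrite -powR_mulrn ?(ltW dt0)// -powRD ?subrK// (gt_eqF dt0) implybT.
  apply: ler_wpM2r; first exact: sqr_ge0.
  apply: ge0_ler_powR; rewrite ?nnegrE ?subr_ge0 ?(ltW dt0) /N//.
  exact: cmod_dirichlet_le.
have [N0|[-> _]] := Npos_or_null; first by rewrite powN_conj.
by rewrite mulr0 powR_ge0.
Qed.

(** A fourth moment of the order of the square of the second moment prevents
the lower moments from being small: [s^(p/2) >= s - s^2 / 4] for [s >= 0], and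
the right-hand side has mean at least [1 - 2/4]. *)
Lemma Hnorm_ge_fourth p v : 0 < N -> 1 <= p -> p <= 2 ->
  is_mean (fun t => d t ^+ 4) v -> v <= 2 * N ^+ 2 ->
  ((2^-1 * N `^ 2^-1)%:E <= Hnorm lambda p%:E A a)%E.
Proof.
move=> N0 p1 p2 dv v2; have p0 : 0 < p by exact: lt_le_trans p1.
have x0 : 0 <= 2^-1 * N `^ 2^-1 by rewrite mulr_ge0 ?powR_ge0.
apply: (Hnorm_ge p1 x0 (is_meanZ (N `^ (p / 2))
  (is_meanD (s_mean N0) (is_meanZ (- (4^-1 * N^-1 ^+ 2)) dv)))).
  move=> t; rewrite -/(d t) (Dpow _ _ N0) ler_wpM2l ?powR_ge0//.
  have -> : - (4^-1 * N^-1 ^+ 2) * d t ^+ 4 = - (4^-1 * (N^-1 * d t ^+ 2) ^+ 2).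
    by ring.
  have := s0 t; move: (N^-1 * d t ^+ 2) => s s_ge0.
  have [s1|s1] := leP s 1.
    have : s <= s `^ (p / 2).
      move: s_ge0; rewrite le_eqVlt => /predU1P[<-|s_gt0]; first exact: powR_ge0.
      by apply: ger1_powR; rewrite ?s_gt0//; lra.
    by have := sqr_ge0 s; lra.
  have hs : Num.sqrt s <= s `^ (p / 2).
    rewrite -powR12_sqrt//; apply: ler_powR; first exact: ltW.
    by rewrite ler_pdivlMr// mulVf.
  apply: le_trans hs; rewrite -[X in X + _](sqr_sqrtr s_ge0).
  rewrite -[X in _ * X ^+ 2](sqr_sqrtr s_ge0).
  have := sqrtr_ge0 s; move: (Num.sqrt s) => u u0.
  (* In u = sqrt s the claim is u^3 - 4 u + 4 >= 0; subtracting
     (u - 6/5)^2 (u + 12/5) >= 0 leaves a positive affine function. *)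
  have : 0 <= u * ((u - 6 / 5) ^+ 2 * (u + 12 / 5)).
    by apply: mulr_ge0 => //; apply: mulr_ge0; [exact: sqr_ge0|lra].
  by have := sqr_ge0 u; nra.
rewrite powRM ?powR_ge0// sqrtN mulrC ler_wpM2l ?powR_ge0//.
have : 2^-1 `^ p <= 2^-1 :> R by apply: ge1r_powR => //; apply/andP; split; lra.
have : N^-1 ^+ 2 * v <= 2.
  by rewrite exprVn mulrC ler_pdivrMr// exprn_gt0.
lra.
Qed.

(** With [s = |D|^2 / N] and [p/2 <= k], one has [s^(p/2) <= 1 + s^k]. *)
Lemma Hnorm_le_moment p (k : nat) (C v : R) : 0 < N -> 1 <= p -> p <= 2 * k%:R ->
  0 <= C -> is_mean (fun t => d t ^+ k.*2) v -> v <= C * N ^+ k ->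
  (Hnorm lambda p%:E A a <= ((1 + C) * N `^ 2^-1)%:E)%E.
Proof.
move=> N0 p1 pk C0 dv vC; have p0 : 0 < p by exact: lt_le_trans p1.
have x0 : 0 <= (1 + C) * N `^ 2^-1 by rewrite mulr_ge0 ?powR_ge0//; lra.
apply: (Hnorm_le p1 x0
  (is_meanZ (N `^ (p / 2)) (is_mean_affine 1 (N^-1 ^+ k) dv))).
  move=> t; rewrite -/(d t) (Dpow _ _ N0) ler_wpM2l ?powR_ge0//.
  have -> : N^-1 ^+ k * d t ^+ k.*2 = (N^-1 * d t ^+ 2) ^+ k.
    by rewrite exprMn -exprM mul2n.
  have := s0 t; move: (N^-1 * d t ^+ 2) => s s_ge0.
  have [s1|s1] := leP s 1.
    apply: (@le_trans _ _ 1); last by rewrite lerDl exprn_ge0.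
    have p21 : 1 `^ (p / 2) = 1 :> R by rewrite powR1.
    rewrite -[leRHS]p21; apply: ge0_ler_powR; rewrite ?nnegrE//.
    by rewrite divr_ge0// ltW.
  rewrite -powR_mulrn//; apply: (@le_trans _ _ (s `^ k%:R)); last by lra.
  by apply: ler_powR; [exact: ltW|lra].
rewrite powRM ?powR_ge0//; last lra.
rewrite sqrtN mulrC ler_wpM2r ?powR_ge0//.
apply: (@le_trans _ _ (1 + C)); last by apply: le1r_powR => //; lra.
rewrite lerD2l exprVn mulrC ler_pdivrMr//; exact: exprn_gt0.
Qed.

End Unimodular.
End Norms.

(** * Special index sets *)
Section SpecialSets.
Context {R : realType}.
Implicit Types (A : {fset nat}).

Lemma fset_of_uniq (s : seq nat) : uniq s -> exists A, perm_eq A s.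
Proof.
move=> us; exists [fset n | n in s]%fset.
by apply: uniq_perm => // n; rewrite in_fset.
Qed.

Variable lambda : nat -> R.
Hypothesis hlambda : frequency lambda.

Lemma frequency_inj : injective lambda.
Proof.
have [_ lt_lambda _] := hlambda => m n mn.
have [/lt_lambda|/lt_lambda|//] := ltngtP m n; by rewrite mn ltxx.
Qed.

(** Unboundedness of the frequency allows each term to be chosen larger than a
given multiple of the previous one. *)
Lemma ex_sparse_subsequence (k : nat) : exists sigma : nat -> nat,
  (forall N, 0 < lambda (sigma N)) /\
  forall i N, (i < N)%N -> k.+1%:R * lambda (sigma i) <= lambda (sigma N).
Proof.
have [lambda0 _ unbounded] := hlambda.
have large x : exists n, x < lambda n.
  apply: contrapT => /forallNP H; apply: unbounded; exists x => _ [n _ <-].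
  by have /negP := H n; rewrite -leNgt.
have /choice[next Hnext] : forall n, exists m, k.+1%:R * lambda n < lambda m.
  by move=> n; exact: large.
pose sigma N := iter N.+1 next 0%N.
have sigma0 N : 0 < lambda (sigma N).
  by apply: le_lt_trans (Hnext _); rewrite mulr_ge0.
have sigmaS N : k.+1%:R * lambda (sigma N) <= lambda (sigma N.+1).
  exact/ltW/Hnext.
exists sigma; split => // i; elim=> // N IH; rewrite ltnS leq_eqVlt.
move=> /predU1P[->//|iN]; apply: le_trans (IH iN) _.
apply: le_trans (sigmaS N); rewrite ler_peMl ?(ltW (sigma0 N))//.
by rewrite ler1n.
Qed.

Lemma ex_sparse_fset (k N : nat) : exists2 A, #|` A| = N &
  forall j, (j <= k)%N -> exists2 v,
    is_mean (fun t => cmod (dirichlet_poly lambda A (fun=> 1) (0 +i* t)) ^+ j.*2) v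
    & v <= j`!%:R * N%:R ^+ j.
Proof.
(* A ratio k + 2 > 1 also makes sigma injective when k = 0. *)
have [sigma [sigma0 sparse]] := ex_sparse_subsequence k.+1.
have sigma_inj : injective sigma.
  have lt_sigma i j : (i < j)%N -> lambda (sigma i) < lambda (sigma j).
    move=> ij; apply: lt_le_trans (sparse _ _ ij).
    by rewrite ltr_pMl// ltr1n.
  move=> i j ij; have [/lt_sigma|/lt_sigma|//] := ltngtP i j;
    by rewrite ij ltxx.
have [|A Aperm] := @fset_of_uniq (map sigma (iota 0 N)).
  by rewrite map_inj_uniq// iota_uniq.
exists A; first by rewrite (perm_size Aperm) size_map size_iota.
have [|v Hv] := @moment_sparse R k (lambda \o sigma) sigma0 _ N.
  move=> i j ij; apply: le_trans (sparse i j ij).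
  by rewrite ler_wpM2r ?(ltW (sigma0 i))// ler_nat.
move=> j jk; have [vm vle] := Hv j jk; exists (v j) => //.
rewrite (_ : (fun t => _) = (fun t =>
  cmod (\sum_(0 <= i < N) ee (- (lambda \o sigma) i) t) ^+ j.*2))//.
apply/funext => t; rewrite dirichlet_line (perm_big _ Aperm)/= big_map.
by rewrite /index_iota subn0; congr (cmod _ ^+ _); apply: eq_bigr => i _; rewrite mul1r.
Qed.

End SpecialSets.

(** * Comparison of unimodular coefficients with indicators *)
Section Convexity.
Context {R : realType}.
Implicit Types (p x y : R) (A : {fset nat}).

Lemma powR_convex p x y c : 1 <= p -> 0 <= x -> 0 <= y -> 0 <= c <= 1 ->
  ((1 - c) * x + c * y) `^ p <= (1 - c) * x `^ p + c * y `^ p.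
Proof.
move=> p1 x0 y0 /andP[c0 c1]; have p0 : 0 < p by exact: lt_le_trans p1.
have [z zE] : {z | z = (1 - c) * x + c * y} by exists ((1 - c) * x + c * y).
rewrite -zE.
have c1' : 0 <= 1 - c by rewrite subr_ge0.
have : 0 <= z by rewrite zE addr_ge0// mulr_ge0.
rewrite le_eqVlt => /predU1P[<-|z0].
  by rewrite powR0 ?gt_eqF// addr_ge0// mulr_ge0// powR_ge0.
have tangent u : 0 <= u -> z `^ p * (1 + p * (z^-1 * u - 1)) <= u `^ p.
  move=> u0; have zu0 : 0 <= z^-1 * u by rewrite mulr_ge0// invr_ge0 ltW.
  have -> : u `^ p = z `^ p * (z^-1 * u) `^ p.
    by rewrite -powRM ?(ltW z0)// mulrA divff ?gt_eqF// mul1r.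
  by rewrite ler_wpM2l ?powR_ge0// powR_ge_tangent.
have hx : (1 - c) * (z `^ p * (1 + p * (z^-1 * x - 1))) <= (1 - c) * x `^ p.
  by rewrite ler_wpM2l// tangent.
have hy : c * (z `^ p * (1 + p * (z^-1 * y - 1))) <= c * y `^ p.
  by rewrite ler_wpM2l// tangent.
apply: le_trans (lerD hx hy).
rewrite [leRHS](_ : _
  = z `^ p * (1 + p * (z^-1 * ((1 - c) * x + c * y) - 1))); last by ring.
by rewrite -zE mulVf ?gt_eqF// subrr mulr0 addr0 mulr1.
Qed.

Lemma powRD_le p x y : 1 <= p -> 0 <= x -> 0 <= y ->
  (x + y) `^ p <= 2 `^ p * (x `^ p + y `^ p).
Proof.
move=> p1 x0 y0; have p0 : 0 < p by exact: lt_le_trans p1.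
wlog xy : x y x0 y0 / x <= y.
  move=> H; have [xy|/ltW yx] := leP x y; first exact: H.
  by rewrite addrC [_ `^ p + _]addrC; exact: H.
apply: (@le_trans _ _ (2 `^ p * y `^ p)).
  rewrite -powRM//; apply: ge0_ler_powR; rewrite ?nnegrE ?addr_ge0 ?mulr_ge0//.
    exact: ltW.
  lra.
by rewrite ler_wpM2l ?powR_ge0// lerDr powR_ge0.
Qed.

Variables (p V : R) (e : nat -> R -> R[i]).
Hypothesis p1 : 1 <= p.
Hypothesis Te : forall n, trigpoly setT (e n).

(** The mean of the [p]-th power is convex in each coefficient separately, so a
coefficient in the unit interval may be moved to 0 or to 1; the summand [g]
collects the exponentials whose coefficient was moved to 1. *)
Lemma mean_powR_vertex (s : seq nat) (w : nat -> R) (g : R -> R[i]) :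
  trigpoly setT g -> (forall n, n \in s -> 0 <= w n <= 1) ->
  (forall B, subseq B s -> exists2 l,
     is_mean (fun t => cmod (g t + \sum_(n <- B) e n t) `^ p) l & l <= V) ->
  exists2 l, is_mean
    (fun t => cmod (g t + \sum_(n <- s) (w n)%:C * e n t) `^ p) l & l <= V.
Proof.
elim: s g => [|n s IH] g Tg w01 H.
  have [l lm lV] := H [::] (sub0seq _); exists l; last exact: lV.
  have -> : (fun t => cmod (g t + \sum_(n <- [::]) (w n)%:C * e n t) `^ p)
      = (fun t => cmod (g t + \sum_(n <- [::]) e n t) `^ p); last exact: lm.
  by apply/funext => t; rewrite !big_nil.
have w01' m : m \in s -> 0 <= w m <= 1.
  by move=> ms; apply: w01; rewrite in_cons ms orbT.
have [l0 m0 l0V] := IH g Tg w01' (fun B BS => H B (subseq_trans BS (subseq_cons _ _))).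
have [||l1 m1 l1V] := IH (fun t => g t + e n t) _ w01'.
- exact: trigpolyD.
- move=> B Bs; have [|l lm lV] := H (n :: B); first by rewrite /= eqxx.
  exists l; last exact: lV.
  have -> : (fun t => cmod (g t + e n t + \sum_(m <- B) e m t) `^ p)
      = (fun t => cmod (g t + \sum_(m <- n :: B) e m t) `^ p); last exact: lm.
  by apply/funext => t; rewrite big_cons addrA.
have [|l lm] := @ex_is_mean_powR_cmod R setT
    (fun t => g t + \sum_(m <- n :: s) (w m)%:C * e m t) p _ p1.
  by apply: trigpolyD => //; apply: trigpoly_sum => m _; exact: trigpolyZ.
exists l; first exact: lm.
have /andP[w0 w1] := w01 n (mem_head _ _).
apply: (@le_trans _ _ ((1 - w n) * l0 + w n * l1)); last first.
  have : (1 - w n) * l0 <= (1 - w n) * V by apply: ler_wpM2l => //; rewrite subr_ge0.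
  have : w n * l1 <= w n * V by exact: ler_wpM2l.
  lra.
apply: is_mean_le lm (is_meanD (is_meanZ (1 - w n) m0) (is_meanZ (w n) m1)) _ => t.
apply: le_trans (powR_convex p1 (cmod_ge0 _) (cmod_ge0 _) (w01 n (mem_head _ _))).
set S := \sum_(m <- s) _.
apply: ge0_ler_powR; rewrite ?nnegrE ?cmod_ge0//.
- by apply: le_trans p1.
- by apply: addr_ge0; apply: mulr_ge0; rewrite ?cmod_ge0// subr_ge0.
rewrite big_cons (_ : g t + _ = (1 - w n)%:C * (g t + S) + (w n)%:C * (g t + e n t + S)).
  apply: le_trans (ler_cmodD _ _) _.
  by rewrite !cmodM !cmodC !ger0_norm// subr_ge0.
by rewrite -/S rmorphB rmorph1; ring.
Qed.

End Convexity.

Section UnimodularComparison.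
Context {R : realType}.
Implicit Types (p y : R) (A B : {fset nat}).
Variable lambda : nat -> R.

(** Positive and negative parts of the real and imaginary parts of the
coefficients take values in the unit interval; the four resulting sums are
recombined by [powRD_le], applied twice. *)
Lemma Hnorm_unimodular_le p y A (a : nat -> R[i]) : 1 <= p -> 0 <= y ->
  unimodular A a ->
  (forall B, (#|` B| <= #|` A|)%N ->
     (Hnorm lambda p%:E B (fun=> 1%R) <= y%:E)%E) ->
  (Hnorm lambda p%:E A a <= (16 * y)%:E)%E.
Proof.
move=> p1 y0 a1 HB; have p0 : 0 < p by exact: lt_le_trans p1.
pose e n t : R[i] := ee (- lambda n) t.
have Te n : trigpoly setT (e n).
  rewrite (_ : e n = (fun t => 1 * ee (- lambda n) t)).
    exact: trigpoly_term.
  by apply/funext => t; rewrite mul1r.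
have vertex (w : nat -> R) : (forall n, n \in (A : seq nat) -> 0 <= w n <= 1) ->
    exists2 l, is_mean
      (fun t => cmod (\sum_(n <- A) (w n)%:C * e n t) `^ p) l & l <= y `^ p.
  move=> w01; have [|||l lm lV] := @mean_powR_vertex R p (y `^ p) e p1 Te A w (fun=> 0).
  - exact: trigpoly0.
  - exact: w01.
  - move=> B BA.
    have [C CB] := fset_of_uniq (subseq_uniq BA (fset_uniq A)).
    have [l Dl] := ex_is_mean_dirichlet lambda C (fun=> 1) p1.
    exists l.
      rewrite (_ : (fun t => _) = (fun t =>
        cmod (dirichlet_poly lambda C (fun=> 1) (0 +i* t)) `^ p)); first exact: Dl.
      apply/funext => t; rewrite dirichlet_line (perm_big _ CB) add0r.
      by congr (cmod _ `^ _); apply: eq_bigr => n _; rewrite mul1r.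
    have := HB C; rewrite (perm_size CB) size_subseq// => /(_ isT).
    rewrite (HnormE p1 Dl) lee_fin => ly.
    have l0 : 0 <= l.
      by apply: is_mean_le (is_mean_cst 0) Dl _ => t; exact: powR_ge0.
    have -> : l = (l `^ p^-1) `^ p by rewrite -powRrM mulVf ?gt_eqF// powRr1.
    by apply: ge0_ler_powR; rewrite ?nnegrE ?powR_ge0 ?(ltW p0).
  exists l; last exact: lV.
  rewrite (_ : (fun t => _) = (fun t =>
    cmod (0 + \sum_(n <- A) (w n)%:C * e n t) `^ p)); first exact: lm.
  by apply/funext => t; rewrite add0r.
have aRe n : n \in A -> -1 <= complex.Re (a n) <= 1 /\ -1 <= complex.Im (a n) <= 1.
  move=> nA; have := a1 n nA; have := sqr_cmod (a n) => h h1.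
  by rewrite h1 expr1n in h; split; apply/andP; split; nra.
pose pos (x : R) : R := Num.max 0 x.
have pos01 x : -1 <= x <= 1 -> 0 <= pos x <= 1.
  by move=> /andP[_ x1]; rewrite /pos le_max lexx ge_max ler01 x1.
have pos01N x : -1 <= x <= 1 -> 0 <= pos (- x) <= 1.
  by move=> /andP[x1 _]; rewrite /pos le_max lexx ge_max ler01/=; lra.
have posB x : x = pos x - pos (- x).
  by rewrite /pos; case: (leP 0 x) => ?; case: (leP 0 (- x)) => ?; lra.
have [|l1 m1 y1] := vertex (fun n => pos (complex.Re (a n))).
  by move=> n nA; apply: pos01; have [] := aRe n nA.
have [|l2 m2 y2] := vertex (fun n => pos (- complex.Re (a n))).
  by move=> n nA; apply: pos01N; have [] := aRe n nA.
have [|l3 m3 y3] := vertex (fun n => pos (complex.Im (a n))).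
  by move=> n nA; apply: pos01; have [] := aRe n nA.
have [|l4 m4 y4] := vertex (fun n => pos (- complex.Im (a n))).
  by move=> n nA; apply: pos01N; have [] := aRe n nA.
have y16 : 0 <= 16 * y by rewrite mulr_ge0.
apply: (Hnorm_le p1 y16 (is_meanZ (2 `^ p * 2 `^ p)
  (is_meanD (is_meanD m1 m2) (is_meanD m3 m4)))).
  move=> t; rewrite dirichlet_line.
  set F1 := \sum_(n <- A) (pos (complex.Re (a n)))%:C * _.
  set F2 := \sum_(n <- A) (pos (- complex.Re (a n)))%:C * _.
  set F3 := \sum_(n <- A) (pos (complex.Im (a n)))%:C * _.
  set F4 := \sum_(n <- A) (pos (- complex.Im (a n)))%:C * _.
  have -> : \sum_(n <- A) a n * ee (- lambda n) t
      = (F1 + - F2) + (0 +i* 1) * (F3 + - F4).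
    rewrite /F1 /F2 /F3 /F4 -!sumrB mulr_sumr -big_split /=.
    apply: eq_bigr => n _; rewrite -!mulrBl mulrA -mulrDl; congr (_ * _).
    rewrite -!rmorphB /= -!posB; case: (a n) => x z.
    by apply/eqP; rewrite eq_complex /=; apply/andP; split; apply/eqP; ring.
  have cmodi : cmod (0 +i* 1 : R[i]) = 1.
    by rewrite /cmod /= expr0n /= add0r expr1n sqrtr1.
  have h12 : cmod (F1 + - F2) `^ p <= 2 `^ p * (cmod F1 `^ p + cmod F2 `^ p).
    apply: le_trans (powRD_le p1 (cmod_ge0 _) (cmod_ge0 _)).
    apply: ge0_ler_powR; rewrite ?nnegrE ?addr_ge0 ?cmod_ge0 ?(ltW p0)//.
    by apply: le_trans (ler_cmodD _ _) _; rewrite cmodN.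
  have h34 : cmod (F3 + - F4) `^ p <= 2 `^ p * (cmod F3 `^ p + cmod F4 `^ p).
    apply: le_trans (powRD_le p1 (cmod_ge0 _) (cmod_ge0 _)).
    apply: ge0_ler_powR; rewrite ?nnegrE ?addr_ge0 ?cmod_ge0 ?(ltW p0)//.
    by apply: le_trans (ler_cmodD _ _) _; rewrite cmodN.
  apply: (@le_trans _ _
    (2 `^ p * (cmod (F1 + - F2) `^ p + cmod (F3 + - F4) `^ p))).
    apply: le_trans (powRD_le p1 (cmod_ge0 _) (cmod_ge0 _)).
    apply: ge0_ler_powR; rewrite ?nnegrE ?addr_ge0 ?cmod_ge0 ?(ltW p0)//.
    by apply: le_trans (ler_cmodD _ _) _; rewrite cmodM cmodi mul1r.
  rewrite -mulrA ler_wpM2l ?powR_ge0// mulrDr; exact: lerD.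
have -> : (16 * y) `^ p = (2 `^ p * 2 `^ p) * (4 `^ p * y `^ p).
  by rewrite -!powRM// ?mulr_ge0//; congr (_ `^ _); ring.
rewrite ler_wpM2l ?mulr_ge0 ?powR_ge0//.
have : 4 * y `^ p <= 4 `^ p * y `^ p.
  by rewrite ler_wpM2r ?powR_ge0// le1r_powR// ler1n.
lra.
Qed.

Hypothesis hlambda : frequency lambda.

(** The blocks are cut along the increasing enumeration of [A], so that the
spectra of successive blocks are separated; the terms after the last full block
form the remaining summand. *)
Lemma littlewood_dirichlet A (a : nat -> R[i]) l J : unimodular A a ->
  (\sum_(0 <= i < J) 4 ^ i <= #|` A|)%N ->
  is_mean (fun t => cmod (dirichlet_poly lambda A a (0 +i* t))) l ->
  J%:R / 2 <= 33 * l.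
Proof.
move=> a1 JA Dl; have [_ lt_lambda _] := hlambda.
pose s := sort leq A.
have sA : perm_eq s A by rewrite perm_sort.
have us : uniq s by rewrite sort_uniq fset_uniq.
have ss : sorted ltn s by rewrite ltn_sorted_uniq_leq us sort_sorted//; exact: leq_total.
pose b j := if (j <= J)%N then (\sum_(0 <= i < j) 4 ^ i)%N else size s.
have bJ j : (j <= J)%N -> b j = (\sum_(0 <= i < j) 4 ^ i)%N by rewrite /b => ->.
have bJs : (b J <= size s)%N by rewrite bJ// (perm_size sA).
have bmono j : (b j <= b j.+1)%N.
  have [jJ|Jj|->] := ltngtP j J.
  - by rewrite (bJ _ jJ) (bJ _ (ltnW jJ)) big_nat_recr//= leq_addr.
  - by rewrite /b ifN -?ltnNge// ifN// -ltnNge ltnW.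
  - by rewrite {2}/b ltnn.
have bmono' i j : (i <= j)%N -> (b i <= b j)%N.
  move=> ij; rewrite -(subnKC ij); elim: (j - i)%N => [|n IH]; first by rewrite addn0.
  by rewrite addnS; exact: leq_trans IH (bmono _).
have bsize j : (b j <= size s)%N.
  by have [jJ|Jj] := leqP j J; [exact: leq_trans (bmono' _ _ jJ) bJs
    |rewrite /b ifN// -ltnNge].
pose r j := [seq nth 0%N s k | k <- index_iota (b j) (b j.+1)].
pose P j t : R[i] := \sum_(n <- r j) a n * ee (- lambda n) t.
pose Lam j : set R := [set - lambda n | n in [set n | n \in r j]].
have rP j n : n \in r j -> exists2 k, (b j <= k < b j.+1)%N & n = nth 0%N s k.
  by move=> /mapP[k]; rewrite mem_index_iota => kb ->; exists k.
have rA j n : n \in r j -> n \in A.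
  move=> /rP[k /andP[_ kb] ->]; rewrite -(perm_mem sA) mem_nth//.
  exact: leq_trans kb (bsize _).
have ur j : uniq (r j).
  rewrite map_inj_in_uniq ?iota_uniq// => k k'; rewrite !mem_index_iota.
  move=> /andP[_ kb] /andP[_ kb'] /eqP.
  by rewrite nth_uniq ?(leq_trans kb (bsize _)) ?(leq_trans kb' (bsize _))// => /eqP.
have sizer j : (j < J)%N -> size (r j) = (4 ^ j)%N.
  move=> jJ; rewrite size_map size_iota !bJ// ?(ltnW jJ)// big_nat_recr//=.
  by rewrite addKn.
have ra j (q : nat) : (j < J)%N -> \sum_(n <- r j) cmod (a n) ^+ q = 4 ^+ j.
  move=> jJ; rewrite (eq_big_seq (fun=> 1)); last first.
    by move=> n /rA nA; rewrite a1// expr1n.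
  by rewrite big_const_seq count_predT iter_addr_0 sizer// natrX.
apply: (@littlewood_blocks R J P Lam).
- move=> j _; apply: trigpoly_sum => n nr; apply: trigpoly_term.
  by exists n.
- move=> i j _ _ ij [n /= ni <-] [m /= mj <-]; rewrite ltrN2; apply: lt_lambda.
  have [k /andP[_ kb] ->] := rP _ _ ni; have [k' /andP[k'b k'b'] ->] := rP _ _ mj.
  have kk' : (k < k')%N.
    exact: leq_trans kb (leq_trans (bmono' _ _ ij) k'b).
  have k's : (k' < size s)%N by exact: leq_trans k'b' (bsize _).
  by apply: (sorted_ltn_nth ltn_trans 0%N ss) => //; rewrite inE//; exact: ltn_trans k's.
- move=> j jJ t; apply: le_trans (ler_cmod_sum _ _) _.
  rewrite -(ra j 1%N jJ); apply: ler_sum => n _.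
  by rewrite cmodM cmod_ee mulr1.
- move=> j jJ; rewrite -(ra j 2 jJ).
  apply: (@parseval _ (fun n => - lambda n)) => // m n /oppr_inj.
  exact: frequency_inj.
rewrite (_ : (fun t => _)
  = (fun t => cmod (dirichlet_poly lambda A a (0 +i* t))))//.
apply/funext => t; congr cmod; rewrite dirichlet_line -(perm_big _ sA) /P /=.
rewrite [RHS](big_nth 0%N).
have -> : size s = b J.+1 by rewrite /b ltnn.
elim: (J.+1) => [|j IH]; first by rewrite !big_geq// /b leq0n big_geq.
by rewrite big_nat_recr//= IH /r big_map -big_cat_nat.
Qed.

End UnimodularComparison.

(** * Democracy functions *)
Section Asymptotics.
Context {R : realType}.
Implicit Types f g h : nat -> \bar R.

Lemma lesssim_trans f g h : lesssim f g -> lesssim g h -> lesssim f h.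
Proof.
move=> [C C0 fg] [D D0 gh]; exists (C * D); first exact: mulr_gt0.
move=> N N0; apply: le_trans (fg N N0) _.
by rewrite EFinM -muleA lee_pmul2l// ?lte_fin// gh.
Qed.

Lemma lesssim_le f g :
  (forall N, (0 < N)%N -> (f N <= g N)%E) -> lesssim f g.
Proof. by move=> fg; exists 1 => // N N0; rewrite mul1e fg. Qed.

End Asymptotics.

Section Democracy.
Context {R : realType}.
Implicit Types (p : R) (A : {fset nat}) (N : nat).
Variable lambda : nat -> R.
Hypothesis hlambda : frequency lambda.

Let lambda_inj : injective lambda := frequency_inj hlambda.

Lemma unimodular1 A : unimodular A (fun=> 1 : R[i]).
Proof. by move=> n _; exact: cmod1. Qed.

Let ex_fset N : exists A, #|` A| = N.
Proof. by have [A] := ex_sparse_fset hlambda 0 N; exists A. Qed.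

Lemma phi_lE_le_phi_l (q : \bar R) N : (phi_lE lambda q N <= phi_l lambda q N)%E.
Proof.
apply: ereal_inf_le_tmp => _ [A [NA ->]].
by exists A, (fun=> 1); split => //; exact: unimodular1.
Qed.

Lemma phi_u_le_phi_uE (q : \bar R) N : (phi_u lambda q N <= phi_uE lambda q N)%E.
Proof.
apply: ge_ereal_sup => _ [A [NA ->]]; apply: ereal_sup_ubound.
by exists A, (fun=> 1); split => //; exact: unimodular1.
Qed.

Lemma phi_l_le (q : \bar R) A : (phi_l lambda q #|` A| <= Hnorm lambda q A (fun=> 1%R))%E.
Proof. by apply: ereal_inf_lbound; exists A. Qed.

Lemma phi_u_ge (q : \bar R) A : (Hnorm lambda q A (fun=> 1%R) <= phi_u lambda q #|` A|)%E.
Proof. by apply: ereal_sup_ubound; exists A. Qed.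

Lemma phi_l_lesssim_sqrt_le2 p : 1 <= p -> p <= 2 ->
  lesssim (phi_l lambda p%:E) (powN 2^-1).
Proof.
move=> p1 p2; apply: lesssim_le => N N0; have [A <-] := ex_fset N.
apply: le_trans (phi_l_le _ _) _.
exact: (Hnorm_le_sqrt (@unimodular1 A) lambda_inj p1 p2).
Qed.

Lemma phi_uE_lesssim_sqrt_le2 p : 1 <= p -> p <= 2 ->
  lesssim (phi_uE lambda p%:E) (powN 2^-1).
Proof.
move=> p1 p2; apply: lesssim_le => N N0.
apply: ge_ereal_sup => _ [A [a [AN a1 ->]]].
apply: le_trans (Hnorm_le_sqrt a1 lambda_inj p1 p2) _.
by rewrite lee_fin ge0_ler_powR ?nnegrE ?invr_ge0 ?ler_nat.
Qed.

Lemma sqrt_lesssim_phi_u_le2 p : 1 <= p -> p <= 2 ->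
  lesssim (powN 2^-1) (phi_u lambda p%:E).
Proof.
move=> p1 p2; exists 2 => // N N0.
have [A AN H] := ex_sparse_fset hlambda 2 N; have [v vm v2] := H 2%N isT.
have := @Hnorm_ge_fourth R lambda A (fun=> 1) (@unimodular1 A) lambda_inj p v.
rewrite AN ltr0n => /(_ N0 p1 p2 vm v2) h.
have : ((2^-1 * N%:R `^ 2^-1)%:E <= phi_u lambda p%:E N)%E.
  by apply: le_trans h _; rewrite -AN; exact: phi_u_ge.
have two0 : (0 <= 2%:E :> \bar R)%E by rewrite lee_fin.
move=> h'; have := lee_wpmul2l two0 h'.
by rewrite -EFinM mulrA divff// mul1r.
Qed.

Lemma conj_lesssim_phi_lE p : 1 <= p -> p <= 2 ->
  lesssim (powN (1 - p^-1)) (phi_lE lambda p%:E).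
Proof.
move=> p1 p2; apply: lesssim_le => N N0.
apply: le_ereal_inf_tmp => _ [A [a [NA a1 ->]]].
have A0 : 0 < #|` A|%:R :> R by rewrite ltr0n (leq_trans N0).
apply: le_trans (Hnorm_ge_conj a1 lambda_inj A0 p1 p2).
rewrite lee_fin ge0_ler_powR ?nnegrE ?ler_nat// subr_ge0 invf_le1//.
exact: lt_le_trans p1.
Qed.

Lemma sqrt_lesssim_phi_lE p : 2 <= p ->
  lesssim (powN 2^-1) (phi_lE lambda p%:E).
Proof.
move=> p2; apply: lesssim_le => N N0.
apply: le_ereal_inf_tmp => _ [A [a [NA a1 ->]]].
have A0 : 0 < #|` A|%:R :> R by rewrite ltr0n (leq_trans N0).
apply: le_trans (Hnorm_ge_sqrt a1 lambda_inj A0 p2).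
by rewrite lee_fin ge0_ler_powR ?nnegrE ?ler_nat// invr_ge0.
Qed.

Lemma phi_l_lesssim_sqrt_ge2 p : 2 <= p ->
  lesssim (phi_l lambda p%:E) (powN 2^-1).
Proof.
move=> p2; have p1 : 1 <= p by apply: le_trans p2; rewrite ler1n.
pose k := (Num.truncn p).+1.
have pk : p <= 2 * k%:R.
  have : p < k%:R by exact: Num.Theory.truncnS_gt.
  by have : (0 : R) <= k%:R by []; lra.
exists (1 + k`!%:R); first by rewrite ltr_pwDl.
move=> N N0; have [A AN H] := ex_sparse_fset hlambda k N.
have [v vm vk] := H k (leqnn k).
have := @Hnorm_le_moment R lambda A (fun=> 1) p k k`!%:R v.
rewrite AN ltr0n => /(_ N0 p1 pk (ler0n _ _) vm vk) h.
rewrite /powN -EFinM; apply: le_trans h.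
by rewrite -{1}AN; exact: phi_l_le.
Qed.

Lemma sqrt_lesssim_phi_u_ge2 p : 2 <= p ->
  lesssim (powN 2^-1) (phi_u lambda p%:E).
Proof.
move=> p2; apply: lesssim_le => N N0; have [A AN] := ex_fset N; rewrite -AN.
have A0 : 0 < #|` A|%:R :> R by rewrite ltr0n AN.
apply: le_trans (phi_u_ge _ _).
exact: (Hnorm_ge_sqrt (@unimodular1 A) lambda_inj A0 p2).
Qed.

Lemma phi_uE_lesssim_conj p : 2 <= p ->
  lesssim (phi_uE lambda p%:E) (powN (1 - p^-1)).
Proof.
move=> p2; have p1 : 1 <= p by apply: le_trans p2; rewrite ler1n.
apply: lesssim_le => N N0.
apply: ge_ereal_sup => _ [A [a [AN a1 ->]]].
apply: le_trans (Hnorm_le_conj a1 lambda_inj p2) _.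
rewrite lee_fin ge0_ler_powR ?nnegrE ?ler_nat// subr_ge0 invf_le1//.
exact: lt_le_trans p1.
Qed.

(** Finiteness of [phi_u] turns it into a real bound on the norms of all
indicators, to which [Hnorm_unimodular_le] applies. *)
Lemma phi_uE_lesssim_phi_u p : 1 <= p ->
  lesssim (phi_uE lambda p%:E) (phi_u lambda p%:E).
Proof.
move=> p1; have p0 : 0 < p by exact: lt_le_trans p1.
exists 16 => // N N0.
have u0 : (0 <= phi_u lambda p%:E N)%E.
  have [A <-] := ex_fset N; apply: le_trans (phi_u_ge _ _).
  exact: Hnorm_ge0.
have uN : (phi_u lambda p%:E N <= N%:R%:E)%E.
  apply: ge_ereal_sup => _ [A [AN ->]].
  apply: (Hnorm_le p1 _ (is_mean_cst (N%:R `^ p))) => // t.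
  apply: ge0_ler_powR; rewrite ?nnegrE ?cmod_ge0 ?(ltW p0)//.
  apply: le_trans (cmod_dirichlet_le lambda (@unimodular1 A) t) _.
  by rewrite ler_nat.
have uE : phi_u lambda p%:E N = (fine (phi_u lambda p%:E N))%:E.
  by rewrite fineK// ge0_fin_numE// (le_lt_trans uN)// ltry.
apply: ge_ereal_sup => _ [A [a [AN a1 ->]]].
rewrite uE -EFinM; apply: Hnorm_unimodular_le => //; first exact: fine_ge0.
move=> B BA; rewrite -uE; apply: ereal_sup_ubound; exists B; split => //.
exact: leq_trans AN.
Qed.

(** The first [K + 1] blocks have at most [5^K] terms in total, and [K + 1] is of
the order of [ln N] when [5^K <= N < 5^(K+1)]. *)
Lemma log_lesssim_phi_lE1 : lesssim logN (phi_lE lambda 1%:E).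
Proof.
have ln5 : 0 < ln 5 :> R by rewrite ln_gt0// ltr1n.
exists (ln 5 * 66); first by rewrite mulr_gt0.
move=> N N0.
have /andP[KN NK] := trunc_log_bounds (isT : (1 < 5)%N) N0.
move: (trunc_log 5 N) KN NK => K KN NK.
have sum5 : (\sum_(0 <= i < K.+1) 4 ^ i <= N)%N.
  apply: leq_trans KN; elim: K {NK} => [|K IH]; first by rewrite big_nat1.
  rewrite big_nat_recl//=.
  under eq_bigr do rewrite expnS.
  rewrite -big_distrr /=.
  by rewrite expn0 (expnS 5) (mulSn 4 (5 ^ K)) leq_add ?expn_gt0// leq_mul.
suff h : ((K.+1%:R / 66)%:E <= phi_lE lambda 1%:E N)%E.
  have := @lee_wpmul2l R (ln 5 * 66)%:E _ _ _ h; rewrite -EFinM => /(_ _) h'.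
  apply: le_trans (h' _); last by rewrite lee_fin mulr_ge0// ltW.
  rewrite lee_fin (_ : ln 5 * 66 * _ = ln 5 *+ K.+1); last first.
    by rewrite -mulr_natr; field.
  rewrite -lnXn// ler_ln ?posrE ?ltr0n ?exprn_gt0//.
  by rewrite -natrX ler_nat ltnW.
apply: le_ereal_inf_tmp => _ [A [a [NA a1 ->]]].
have [l Dl] := ex_is_mean_dirichlet lambda A a (lexx 1).
rewrite (HnormE (lexx 1) Dl) invr1 powRr1; last first.
  by apply: is_mean_le (is_mean_cst 0) Dl _ => t; exact: powR_ge0.
have {}Dl : is_mean (fun t => cmod (dirichlet_poly lambda A a (0 +i* t))) l.
  rewrite (_ : (fun t => _) =
    (fun t => cmod (dirichlet_poly lambda A a (0 +i* t)) `^ 1))//.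
  by apply/funext => t; rewrite powRr1// cmod_ge0.
have := littlewood_dirichlet hlambda a1 (leq_trans sum5 NA) Dl.
by rewrite lee_fin; lra.
Qed.

Lemma Hnorm_infty_le A a : unimodular A a ->
  (Hnorm lambda +oo%E A a <= #|` A|%:R%:E)%E.
Proof.
move=> a1; apply: ge_ereal_sup => _ [t _ <-].
by rewrite lee_fin; exact: cmod_dirichlet_le.
Qed.

Lemma Hnorm_infty1 A : Hnorm lambda +oo%E A (fun=> 1) = #|` A|%:R%:E.
Proof.
apply/eqP; rewrite eq_le Hnorm_infty_le ?andTb; last exact: unimodular1.
apply: ereal_sup_ubound; exists 0 => //; congr (_%:E).
rewrite dirichlet_line (eq_bigr (fun=> 1)); last first.
  by move=> n _; rewrite /ee !mulr0 cos0 sin0 mul1r.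
rewrite big_const_seq count_predT iter_addr_0 -(rmorph_nat (real_complex R)).
by rewrite cmodC ger0_norm.
Qed.

Lemma Hnorm_infty_ge_sqrt A a : unimodular A a ->
  ((#|` A|%:R `^ 2^-1)%:E <= Hnorm lambda +oo%E A a)%E.
Proof.
move=> a1; set S := Hnorm _ _ _ _.
have S_ub t : ((cmod (dirichlet_poly lambda A a (0 +i* t)))%:E <= S)%E.
  by apply: ereal_sup_ubound; exists t.
have S0 : (0 <= S)%E by apply: le_trans (S_ub 0); rewrite lee_fin cmod_ge0.
have SE : S = (fine S)%:E.
  by rewrite fineK// ge0_fin_numE// (le_lt_trans (Hnorm_infty_le a1))// ltry.
rewrite SE lee_fin powR12_sqrt// -(ger0_norm (fine_ge0 S0)) -sqrtr_sqr.
apply: ler_wsqrtr.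
apply: is_mean_le (mean_sqr_unimodular a1 lambda_inj) (is_mean_cst _) _ => t.
rewrite ler_pXn2r ?nnegrE ?cmod_ge0 ?fine_ge0//.
by rewrite -lee_fin -SE.
Qed.

Lemma phi_l_infty N : phi_l lambda +oo%E N = N%:R%:E.
Proof.
apply/eqP; rewrite eq_le; apply/andP; split.
  have [A <-] := ex_fset N; apply: le_trans (phi_l_le _ _) _.
  by rewrite Hnorm_infty1.
apply: le_ereal_inf_tmp => _ [A [NA ->]].
by rewrite Hnorm_infty1 lee_fin ler_nat.
Qed.

Lemma phi_uE_infty N : phi_uE lambda +oo%E N = N%:R%:E.
Proof.
apply/eqP; rewrite eq_le; apply/andP; split.
  apply: ge_ereal_sup => _ [A [a [AN a1 ->]]].
  by apply: le_trans (Hnorm_infty_le a1) _; rewrite lee_fin ler_nat.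
have [A <-] := ex_fset N; apply: le_trans (phi_u_le_phi_uE _ _).
by apply: le_trans (phi_u_ge _ _); rewrite Hnorm_infty1.
Qed.

Lemma phi_u_infty N : phi_u lambda +oo%E N = N%:R%:E.
Proof.
apply/eqP; rewrite eq_le -{1}(phi_uE_infty N) phi_u_le_phi_uE /=.
have [A <-] := ex_fset N.
by apply: le_trans (phi_u_ge _ _); rewrite Hnorm_infty1.
Qed.

End Democracy.

Theorem theorem3p1 (R : realType) (lambda : nat -> R)
    (hlambda : frequency lambda) :
  (* (a) p = 1 *)
  (lesssim logN (phi_lE lambda 1%:E) /\
   (forall N : nat, (0 < N)%N ->
      (phi_lE lambda 1%:E N <= phi_l lambda 1%:E N)%E) /\
   lesssim (phi_l lambda 1%:E) (powN 2^-1) /\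
   asympt (phi_u lambda 1%:E) (phi_uE lambda 1%:E) /\
   asympt (phi_uE lambda 1%:E) (powN 2^-1)) /\
  (* (b) 1 < p <= 2 *)
  (forall p p' : R, 1 < p -> p <= 2 -> p^-1 + p'^-1 = 1 ->
   lesssim (powN p'^-1) (phi_lE lambda p%:E) /\
   (forall N : nat, (0 < N)%N ->
      (phi_lE lambda p%:E N <= phi_l lambda p%:E N)%E) /\
   lesssim (phi_l lambda p%:E) (powN 2^-1) /\
   asympt (phi_u lambda p%:E) (phi_uE lambda p%:E) /\
   asympt (phi_uE lambda p%:E) (powN 2^-1)) /\
  (* (c) 2 < p < +oo *)
  (forall p p' : R, 2 < p -> p^-1 + p'^-1 = 1 ->
   asympt (phi_lE lambda p%:E) (phi_l lambda p%:E) /\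
   asympt (phi_l lambda p%:E) (powN 2^-1) /\
   lesssim (powN 2^-1) (phi_u lambda p%:E) /\
   asympt (phi_u lambda p%:E) (phi_uE lambda p%:E) /\
   lesssim (phi_uE lambda p%:E) (powN p'^-1)) /\
  (* (d) p = +oo *)
  (lesssim (powN 2^-1) (phi_lE lambda +oo%E) /\
   (forall N : nat, (0 < N)%N ->
      (phi_lE lambda +oo%E N <= phi_l lambda +oo%E N)%E) /\
   (forall N : nat, (0 < N)%N -> phi_l lambda +oo%E N = (N%:R)%:E) /\
   (forall N : nat, (0 < N)%N -> phi_u lambda +oo%E N = phi_uE lambda +oo%E N) /\
   (forall N : nat, (0 < N)%N -> phi_uE lambda +oo%E N = (N%:R)%:E)).
Proof.
have u_uE (q : \bar R) : lesssim (phi_u lambda q) (phi_uE lambda q).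
  by apply: lesssim_le => N _; exact: phi_u_le_phi_uE.
have lE_l (q : \bar R) : lesssim (phi_lE lambda q) (phi_l lambda q).
  by apply: lesssim_le => N _; exact: phi_lE_le_phi_l.
have u_sqrt (p : R) : 1 <= p -> p <= 2 ->
    asympt (phi_u lambda p%:E) (phi_uE lambda p%:E) /\
    asympt (phi_uE lambda p%:E) (powN 2^-1).
  move=> p1 p2; have le_sqrt := phi_uE_lesssim_sqrt_le2 hlambda p1 p2.
  have ge_sqrt := sqrt_lesssim_phi_u_le2 hlambda p1 p2.
  split; split=> //; [exact: lesssim_trans ge_sqrt|exact: lesssim_trans (u_uE _)].
have conjE (p p' : R) : p^-1 + p'^-1 = 1 -> p'^-1 = 1 - p^-1.
  by move=> <-; rewrite addrC addKr.
split; [|split; [|split]].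
- have le12 : (1 : R) <= 2 by rewrite ler1n.
  split; first exact: log_lesssim_phi_lE1.
  split; first by move=> N _; exact: phi_lE_le_phi_l.
  split; first exact: phi_l_lesssim_sqrt_le2.
  exact: u_sqrt.
- move=> p p' p1 p2 /conjE ->; have {}p1 := ltW p1.
  split; first exact: conj_lesssim_phi_lE.
  split; first by move=> N _; exact: phi_lE_le_phi_l.
  split; first exact: phi_l_lesssim_sqrt_le2.
  exact: u_sqrt.
- move=> p p' p2 /conjE ->; have {}p2 := ltW p2.
  have p1 : 1 <= p by apply: le_trans p2; rewrite ler1n.
  have le_sqrt := phi_l_lesssim_sqrt_ge2 hlambda p2.
  have ge_sqrt := sqrt_lesssim_phi_lE hlambda p2.
  split; first by split=> //; exact: lesssim_trans ge_sqrt.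
  split; first by split=> //; exact: lesssim_trans (lE_l _).
  split; first exact: sqrt_lesssim_phi_u_ge2.
  split; last exact: phi_uE_lesssim_conj.
  by split=> //; exact: phi_uE_lesssim_phi_u.
- split.
    apply: lesssim_le => N N0; apply: le_ereal_inf_tmp => _ [A [a [NA a1 ->]]].
    apply: le_trans (Hnorm_infty_ge_sqrt hlambda a1).
    by rewrite lee_fin ge0_ler_powR ?nnegrE ?ler_nat// invr_ge0.
  split; first by move=> N _; exact: phi_lE_le_phi_l.
  split; first by move=> N _; exact: phi_l_infty.
  split; last by move=> N _; exact: phi_uE_infty.
  by move=> N _; rewrite phi_u_infty// phi_uE_infty.
Qed.
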